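(* Suppose $\hat K=\begin{bmatrix}K_1&\cdots&K_{n_s}\end{bmatrix}$ stabilizes the Markovian jump linear system $x_{t+1}=A_{\omega(t)}x_t+B_{\omega(t)}u_t$ in the mean square sense. Let $\hat K'$ be the one-step natural policy gradient update $$\hat K'=\hat K-\eta\,\nabla C(\hat K)\,\chi_{\hat K}^{-1}.$$ If $$0<\eta\le\frac{1}{2\|\hat R+\hat B^T\hat{\mathcal E}(P^{\hat K})\hat B\|},$$ then $\hat K'$ also stabilizes the system in the mean square sense.
   Context: Setting. In the Markovian jump linear system $x_{t+1}=A_{\omega(t)}x_t+B_{\omega(t)}u_t$, $t=0,1,2,\dots$, one has $x_t\in\mathbb R^d$, $u_t\in\mathbb R^k$, $A_i\in\mathbb R^{d\times d}$, $B_i\in\mathbb R^{d\times k}$ for $i\in\Omega=\{1,\dots,n_s\}$, and $\omega(t)$ is a Markov chain on $\Omega$ with transition probabilities $p_{ij}=\mathbb P(\omega(t+1)=j\mid\omega(t)=i)$ and initial distribution $\rho=(\rho_1,\dots,\rho_{n_s})$. The initial state $x_0\sim\mathcal D$ has finite second moment and is independent of the chain. Let $Q_i\succ0$ ($d\times d$) and $R_i\succ0$ ($k\times k$) be symmetric. Standing assumptions: $\rho_i>0$ for all $i$ and $\mathbb E[x_0x_0^T]\succ0$. Policies. A policy $\hat K=\begin{bmatrix}K_1&\cdots&K_{n_s}\end{bmatrix}$, $K_i\in\mathbb R^{k\times d}$, acts by $u_t=-K_{\omega(t)}x_t$. It stabilizes the system in the mean square sense if the closed loop satisfies $\mathbb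 E[\|x_t\|^2]\to0$ for every initial state and every initial mode distribution. The cost is $$C(\hat K)=\mathbb E_{x_0\sim\mathcal D,\,\omega(0)\sim\rho}\Big[\sum_{t=0}^\infty x_t^TQ_{\omega(t)}x_t+u_t^TR_{\omega(t)}u_t\Big].$$ It is finite and differentiable at mean-square stabilizing $\hat K$, with gradient $\nabla C(\hat K)\in\mathbb R^{k\times dn_s}$ defined by $dC(\hat K)=\mathrm{tr}(d\hat K^T\nabla C(\hat K))$. Notation. For a family $P=(P_j)_{j\in\Omega}$, $\mathcal E_i(P)=\sum_{j=1}^{n_s}p_{ij}P_j$ and $\hat{\mathcal E}(P)=\mathrm{diag}(\mathcal E_1(P),\dots,\mathcal E_{n_s}(P))$. For a mean-square stabilizing $\hat K$, $P^{\hat K}=(P_i^{\hat K})$ is the solution of $P_i^{\hat K}=Q_i+K_i^TR_iK_i+(A_i-B_iK_i)^T\mathcal E_i(P^{\hat K})(A_i-B_iK_i)$, $i\in\Omega$. With $X_i(t)=\mathbb E[x_tx_t^T\mathbf 1_{\omega(t)=i}]$ along the closed loop of $\hat K$, put $\chi_{\hat K}=\mathrm{diag}\big(\sum_{t\ge0}X_1(t),\dots,\sum_{t\ge0}X_{n_s}(t)\big)$. $\hat R=\mathrm{diag}(R_1,\dots,R_{n_s})$, $\hat B=\mathrm{diag}(B_1,\dots,B_{n_s})$ (all block diagonal); $\|\cdot\|$ is the spectral norm. *)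

(* Defs.v *)
From HB Require Import structures.
From mathcomp Require Import all_boot all_order all_algebra.
From mathcomp Require Import all_classical all_reals all_analysis.

Set Implicit Arguments.
Unset Strict Implicit.
Unset Printing Implicit Defensive.

Import Order.TTheory GRing.Theory Num.Theory.
Import numFieldNormedType.Exports.

Local Open Scope classical_set_scope.
Local Open Scope ring_scope.

Section Matrices.
Context {R : realType}.

Definition quad_form (m : nat) (M : 'M[R]_m) (v : 'cV[R]_m) : R :=
  (v^T *m M *m v) 0 0.

Definition sym_posdef (m : nat) (M : 'M[R]_m) : Prop :=
  M^T = M /\ forall v : 'cV[R]_m, v != 0 -> 0 < quad_form M v.

(* The library's norm on matrices is the max norm, hence these two. *)
Definition euclid_norm (m : nat) (v : 'cV[R]_m) : R :=
  Num.sqrt (\sum_i v i 0 ^+ 2).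

Definition spectral_norm (m m' : nat) (M : 'M[R]_(m, m')) : R :=
  sup [set euclid_norm (M *m v) | v in [set v | euclid_norm v <= 1]].

(* Block diagonal matrix whose blocks need not be square; \mxdiag is the
   square case. *)
Definition block_diag (n a b : nat) (M : 'I_n -> 'M[R]_(a, b)) :
    'M[R]_(\sum_(i < n) a, \sum_(j < n) b) :=
  \mxblock_(i < n, j < n) (if i == j then M i else 0).

(* The matrix G with df(x)[H] = tr(H^T G) for every direction H. *)
Definition gradient (m m' : nat) (f : 'M[R]_(m, m') -> R) (x : 'M[R]_(m, m')) :
    'M[R]_(m, m') :=
  xget 0 [set G | forall H, 'd f x H = \tr (H^T *m G)].

Definition stochastic (n : nat) (p : 'M[R]_n) : Prop :=
  (forall i j, 0 <= p i j) /\ (forall i, \sum_j p i j = 1).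

End Matrices.

Section Probability.
Context {R : realType} {dT : measure_display} {T : measurableType dT}.
Variable P : probability T R.

Definition mode_history (n : nat) (omega : nat -> T -> 'I_n) (t : nat)
    (s : nat -> 'I_n) : set T :=
  [set w | forall r, (r <= t)%N -> omega r w = s r].

(* The Markov property P(omega(t+1) = s(t+1) | omega(0..t) = s(0..t))
   = p_{s(t) s(t+1)} is multiplied out so that it also makes sense for
   histories of probability zero. *)
Definition markov_chain (n : nat) (p : 'M[R]_n) (mu : 'I_n -> R)
    (omega : nat -> T -> 'I_n) : Prop :=
  [/\ forall t i, measurable (omega t @^-1` [set i]),
      forall i, P (omega 0%N @^-1` [set i]) = (mu i)%:E
    & forall t s, P (mode_history omega t.+1 s) =
                  (P (mode_history omega t s) * (p (s t) (s t.+1))%:E)%E].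

Definition random_vector (d : nat) (x : T -> 'cV[R]_d) : Prop :=
  forall j, measurable_fun [set: T] (fun w => x w j 0).

Definition sigma_vector (d : nat) (x : T -> 'cV[R]_d) : set (set T) :=
  <<s \bigcup_j preimage_set_system [set: T] (fun w => x w j 0) measurable >>.

Definition sigma_chain (n : nat) (omega : nat -> T -> 'I_n) : set (set T) :=
  <<s \bigcup_t preimage_set_system [set: T] (omega t) [set: set 'I_n] >>.

Definition independent_of_chain (d n : nat) (x : T -> 'cV[R]_d)
    (omega : nat -> T -> 'I_n) : Prop :=
  forall E F, sigma_vector x E -> sigma_chain omega F ->
    P (E `&` F) = (P E * P F)%E.

Definition finite_second_moment (d : nat) (x : T -> 'cV[R]_d) : Prop :=
  ('E_P[fun w => (euclid_norm (x w) ^+ 2)%R] < +oo)%E.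

Definition second_moment (d : nat) (x : T -> 'cV[R]_d) : 'M[R]_d :=
  \matrix_(a, b) fine 'E_P[fun w => ((x w *m (x w)^T) a b)%R].

End Probability.

Section JumpLinearSystem.
Context {R : realType} {n d k : nat}.
Variables (A : 'I_n -> 'M[R]_d) (B : 'I_n -> 'M[R]_(d, k)).
Variable p : 'M[R]_n.
Variables (Q : 'I_n -> 'M[R]_d) (Rw : 'I_n -> 'M[R]_k).

(* A policy is the row [K_1 ... K_n] of n blocks of size k x d. *)
Definition policy := 'M[R]_(k, \sum_(i < n) d).

Definition gain (K : policy) (i : 'I_n) : 'M[R]_(k, d) :=
  submxrow (q_ := fun=> d) K i.

Definition control (K : policy) (i : 'I_n) (x : 'cV[R]_d) : 'cV[R]_k :=
  - (gain K i *m x).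

Fixpoint closed_loop (T : Type) (K : policy) (omega : nat -> T -> 'I_n)
    (x0 : T -> 'cV[R]_d) (t : nat) (w : T) : 'cV[R]_d :=
  if t is s.+1 then
    let i := omega s w in
    let x := closed_loop K omega x0 s w in
    A i *m x + B i *m control K i x
  else x0 w.

(* The law of the chain depends only on mu and p, so quantifying over all its
   realizations quantifies over mu.  The initial states are the vectors of
   R^d. *)
Definition ms_stabilizing (K : policy) : Prop :=
  forall (dT : measure_display) (T : measurableType dT) (P : probability T R)
         (mu : 'I_n -> R) (omega : nat -> T -> 'I_n) (x0 : 'cV[R]_d),
    markov_chain P p mu omega ->
    ('E_P[fun w => (euclid_norm (closed_loop K omega (fun=> x0) t w) ^+ 2)%R])%E
      @[t --> \oo] --> 0%E.

Definition mode_mean (P : 'I_n -> 'M[R]_d) (i : 'I_n) : 'M[R]_d :=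
  \sum_j p i j *: P j.

Definition coupled_lyapunov (K : policy) (P : 'I_n -> 'M[R]_d) : Prop :=
  forall i,
    P i = Q i + (gain K i)^T *m Rw i *m gain K i
          + (A i - B i *m gain K i)^T *m mode_mean P i
              *m (A i - B i *m gain K i).

(* The unique solution when K is mean-square stabilizing; 0 if there is none. *)
Definition lyapunov_sol (K : policy) : 'I_n -> 'M[R]_d :=
  xget (fun=> 0) [set P | coupled_lyapunov K P].

Section WithInitialData.
Context {dT : measure_display} {T : measurableType dT}.
Variable P : probability T R.
Variables (omega : nat -> T -> 'I_n) (x0 : T -> 'cV[R]_d).

Definition stage_cost (K : policy) (t : nat) (w : T) : R :=
  let x := closed_loop K omega x0 t w in
  let i := omega t w in
  quad_form (Q i) x + quad_form (Rw i) (control K i x).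

Definition extended_cost (K : policy) : \bar R :=
  (\int[P]_w \sum_(0 <= t <oo) (stage_cost K t w)%:E)%E.

(* fine sends an infinite cost to 0; the cost is finite at, and around, every
   mean-square stabilizing policy. *)
Definition cost (K : policy) : R := fine (extended_cost K).

Definition mode_moment (K : policy) (i : 'I_n) (t : nat) : 'M[R]_d :=
  \matrix_(a, b) fine 'E_P[fun w =>
    let x := closed_loop K omega x0 t w in
    ((x *m x^T) a b * \1_(omega t @^-1` [set i]) w)%R].

Definition chi (K : policy) : 'M[R]_(\sum_(i < n) d) :=
  \mxdiag_(i < n) (limn (series (mode_moment K i))).

Definition natural_gradient_step (eta : R) (K : policy) : policy :=
  K - eta *: (gradient cost K *m invmx (chi K)).

End WithInitialData.

Definition step_matrix (K : policy) : 'M[R]_(\sum_(i < n) k) :=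
  \mxdiag_(i < n) Rw i
  + (block_diag B)^T *m (\mxdiag_(i < n) mode_mean (lyapunov_sol K) i)
      *m block_diag B.

End JumpLinearSystem.

(* Main.v *)
Require Import Defs.
From HB Require Import structures.
From mathcomp Require Import all_boot all_order all_algebra.
From mathcomp Require Import all_classical all_reals all_analysis.
From mathcomp Require Import measurable_realfun ring lra.
Import Order.TTheory GRing.Theory Num.Theory.
Import numFieldNormedType.Exports.
Local Open Scope classical_set_scope.
Local Open Scope ring_scope.
Set Implicit Arguments.
Unset Strict Implicit.
Unset Printing Implicit Defensive.

(** Write [F_i = A_i - B_i K_i] for the closed-loop matrices and [T] for the
    operator [(T Z)_i = F_i^T (\sum_j p_ij Z_j) F_i] on families of matrices
    ([lyap_op]).  The Markov property gives
    [E(x_(t+1)^T Z_(omega(t+1)) x_(t+1)) = E(x_t^T (T Z)_(omega(t)) x_t)]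
    ([moment_valueS]), so mean-square stability says that the quadratic forms of
    [T^t 1] tend to 0 ([ms_stabilizing_lyap_stable], [lyap_stable_ms_stabilizing]).
    From there on, stability is a matter of comparing quadratic forms, and a family
    [Pi >= 0] with [T Pi <= Pi - W], [W] positive definite, certifies it
    ([lyap_criterion]).

    Let [Pi] be the cost-to-go of the stabilizing policy [K], and put
    [S_i = R_i + B_i^T E_i(Pi) B_i] and [L_i = S_i K_i - B_i^T E_i(Pi) A_i].  The
    gradient of the cost is [2 L chi] ([gradient_cost]) and [chi] is invertible
    ([chi_unit]), so the update reads [K'_i = K_i - 2 eta L_i].  Completing the
    square in the Bellman equation ([bellman_perturbation]), the operator [T'] of
    the new policy satisfies
    [T' Pi = Pi - W' - 4 eta L_i^T (1 - eta S_i) L_i], where [W'] is the stage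
    weight of [K'].  The spectral norm of the block diagonal matrix bounds each of
    its blocks [S_i] ([hessian_le]), so [eta S_i <= 1/2] and [T' Pi <= Pi - W']:
    the cost-to-go of the old policy is a Lyapunov function for the new one
    ([improvement_stable]).

    The gradient formula is obtained without differentiating the trajectory.  For
    a small change [H] of the policy, [T' Pi <= Pi - Q / 2] still holds, so [K + H]
    is stabilizing and has a cost-to-go [Pi'].  Write [Pi' - Pi = Z + U], where [Z]
    solves [Z = (H^T L + L^T H) + T Z], which is linear in [H].  Then [U] solves
    [U = N + T' U] with a source [N] of order [|H|^2], and comparison with a
    multiple of [Pi] shows that [U] itself is of that order
    ([perturbed_solution]).  The initial value of [Z] is the sum over time of
    [E(x_t^T (H^T L + L^T H)_(omega(t)) x_t)] along the unperturbed trajectory,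
    that is [tr(H^T 2 L chi)] ([linear_response_value]). *)

(** * Quadratic and bilinear forms of real matrices *)

Section QuadraticForms.
Context {R : realType}.

Definition bilin (m m' : nat) (M : 'M[R]_(m, m')) (u : 'cV[R]_m)
  (v : 'cV[R]_m') : R := (u^T *m M *m v) 0 0.

Lemma bilinE m m' (M : 'M[R]_(m, m')) u v :
  bilin M u v = \sum_a \sum_b M a b * (u a 0 * v b 0).
Proof.
rewrite /bilin mxE exchange_big /=; apply: eq_bigr => b _.
rewrite mxE mulr_suml; apply: eq_bigr => a _.
by rewrite mxE mulrAC mulrC.
Qed.

Lemma bilinD m m' (M N : 'M[R]_(m, m')) u v :
  bilin (M + N) u v = bilin M u v + bilin N u v.
Proof. by rewrite /bilin mulmxDr mulmxDl mxE. Qed.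

Lemma bilinN m m' (M : 'M[R]_(m, m')) u v : bilin (- M) u v = - bilin M u v.
Proof. by rewrite /bilin mulmxN mulNmx mxE. Qed.

Lemma bilinB m m' (M N : 'M[R]_(m, m')) u v :
  bilin (M - N) u v = bilin M u v - bilin N u v.
Proof. by rewrite bilinD bilinN. Qed.

Lemma bilinZ m m' a (M : 'M[R]_(m, m')) u v :
  bilin (a *: M) u v = a * bilin M u v.
Proof. by rewrite /bilin -scalemxAr -scalemxAl mxE. Qed.

Lemma bilin_sum (I : finType) m m' (M : I -> 'M[R]_(m, m')) u v :
  bilin (\sum_i M i) u v = \sum_i bilin (M i) u v.
Proof. by rewrite /bilin mulmx_sumr mulmx_suml summxE. Qed.

Lemma bilin_mul m m' q q' (F : 'M[R]_(m, q)) (M : 'M[R]_(m, m'))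
    (G : 'M[R]_(m', q')) u v :
  bilin (F^T *m M *m G) u v = bilin M (F *m u) (G *m v).
Proof. by rewrite /bilin trmx_mul !mulmxA. Qed.

Lemma bilin_mull m m' q (F : 'M[R]_(m, q)) (M : 'M[R]_(m, m')) u v :
  bilin (F^T *m M) u v = bilin M (F *m u) v.
Proof. by rewrite /bilin trmx_mul !mulmxA. Qed.

Lemma bilin_mulr m m' q (M : 'M[R]_(m, m')) (G : 'M[R]_(m', q)) u v :
  bilin (M *m G) u v = bilin M u (G *m v).
Proof. by rewrite /bilin !mulmxA. Qed.

Lemma bilin_tr m m' (M : 'M[R]_(m, m')) u v : bilin M^T v u = bilin M u v.
Proof.
rewrite !bilinE exchange_big /=; apply: eq_bigr => a _; apply: eq_bigr => b _.
by rewrite mxE [v _ 0 * _]mulrC.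
Qed.

Lemma bilinC m (M : 'M[R]_m) u v : M^T = M -> bilin M u v = bilin M v u.
Proof. by move=> Ms; rewrite -[LHS]bilin_tr Ms. Qed.

Lemma bilinDl m m' (M : 'M[R]_(m, m')) u u' v :
  bilin M (u + u') v = bilin M u v + bilin M u' v.
Proof. by rewrite /bilin linearD /= !mulmxDl mxE. Qed.

Lemma bilinDr m m' (M : 'M[R]_(m, m')) u v v' :
  bilin M u (v + v') = bilin M u v + bilin M u v'.
Proof. by rewrite /bilin !mulmxDr mxE. Qed.

Lemma bilinZl m m' (M : 'M[R]_(m, m')) a u v :
  bilin M (a *: u) v = a * bilin M u v.
Proof. by rewrite /bilin linearZ /= -!scalemxAl mxE. Qed.

Lemma bilinZr m m' (M : 'M[R]_(m, m')) a u v :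
  bilin M u (a *: v) = a * bilin M u v.
Proof. by rewrite /bilin -!scalemxAr mxE. Qed.

Lemma bilin_delta m m' (M : 'M[R]_(m, m')) a b :
  bilin M (delta_mx a 0) (delta_mx b 0) = M a b.
Proof.
rewrite /bilin trmx_delta -rowE -colE !mxE.
by [].
Qed.

Lemma bilin_eq0 m m' (M : 'M[R]_(m, m')) :
  (forall u v, bilin M u v = 0) -> M = 0.
Proof. by move=> M0; apply/matrixP => a b; rewrite mxE -bilin_delta M0. Qed.

Lemma quad_formD m (M N : 'M[R]_m) v :
  quad_form (M + N) v = quad_form M v + quad_form N v.
Proof. exact: bilinD. Qed.

Lemma quad_formB m (M N : 'M[R]_m) v :
  quad_form (M - N) v = quad_form M v - quad_form N v.
Proof. exact: bilinB. Qed.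

Lemma quad_formZ m a (M : 'M[R]_m) v : quad_form (a *: M) v = a * quad_form M v.
Proof. exact: bilinZ. Qed.

Lemma quad_form_tr m (M : 'M[R]_m) v : quad_form M^T v = quad_form M v.
Proof. exact: bilin_tr. Qed.

Lemma quad_form_mul m q (F : 'M[R]_(m, q)) (M : 'M[R]_m) v :
  quad_form (F^T *m M *m F) v = quad_form M (F *m v).
Proof. exact: bilin_mul. Qed.

Lemma quad_form_vN m (M : 'M[R]_m) v : quad_form M (- v) = quad_form M v.
Proof. by rewrite -[LHS]/(bilin M _ _) -scaleN1r bilinZl bilinZr !mulN1r opprK. Qed.

Lemma quad_form_vD m (M : 'M[R]_m) u v : M^T = M ->
  quad_form M (u + v) = quad_form M u + 2 * bilin M u v + quad_form M v.
Proof.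
move=> Ms; rewrite -[LHS]/(bilin M _ _) bilinDl !bilinDr.
rewrite [bilin M v u]bilinC // -[bilin M u u]/(quad_form M u).
by rewrite -[bilin M v v]/(quad_form M v); lra.
Qed.

Lemma quad_form_vZ m (M : 'M[R]_m) a v :
  quad_form M (a *: v) = a ^+ 2 * quad_form M v.
Proof. by rewrite -[LHS]/(bilin M _ _) bilinZl bilinZr mulrA expr2. Qed.

Lemma quad_form_v0 m (M : 'M[R]_m) : quad_form M 0 = 0.
Proof. by rewrite /quad_form mulmx0 mxE. Qed.

Lemma quad_form1 m (v : 'cV[R]_m) : quad_form 1%:M v = \sum_a v a 0 ^+ 2.
Proof.
by rewrite /quad_form mulmx1 mxE; apply: eq_bigr => a _; rewrite mxE expr2.
Qed.

Lemma quad_form1_ge0 m (v : 'cV[R]_m) : 0 <= quad_form 1%:M v.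
Proof. by rewrite quad_form1 sumr_ge0 // => a _; rewrite sqr_ge0. Qed.

Lemma euclid_normE m (v : 'cV[R]_m) : euclid_norm v ^+ 2 = quad_form 1%:M v.
Proof.
by rewrite quad_form1 sqr_sqrtr // sumr_ge0 // => a _; rewrite sqr_ge0.
Qed.

Lemma sqr_le_quad_form1 m (v : 'cV[R]_m) a : v a 0 ^+ 2 <= quad_form 1%:M v.
Proof.
rewrite quad_form1 (bigD1 a) //= lerDl sumr_ge0 // => b _; exact: sqr_ge0.
Qed.

Lemma normM_le_sqr (x y : R) : `|x * y| <= x ^+ 2 + y ^+ 2.
Proof.
rewrite normrM -(real_normK (num_real x)) -(real_normK (num_real y)).
have := sqr_ge0 (`|x| - `|y|); have := sqr_ge0 (`|x| + `|y|); nra.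
Qed.

Definition entry_sum m m' (M : 'M[R]_(m, m')) : R := \sum_a \sum_b `|M a b|.

Lemma entry_sum_ge0 m m' (M : 'M[R]_(m, m')) : 0 <= entry_sum M.
Proof. by apply: sumr_ge0 => a _; apply: sumr_ge0. Qed.

Lemma bilin_le m m' (M : 'M[R]_(m, m')) u v :
  `|bilin M u v| <= entry_sum M * (quad_form 1%:M u + quad_form 1%:M v).
Proof.
rewrite bilinE (le_trans (ler_norm_sum _ _ _)) // mulr_suml ler_sum // => a _.
rewrite (le_trans (ler_norm_sum _ _ _)) // mulr_suml ler_sum // => b _.
rewrite normrM ler_wpM2l // (le_trans (normM_le_sqr _ _)) // lerD //;
exact: sqr_le_quad_form1.
Qed.

Lemma quad_form_le m (M : 'M[R]_m) v :
  `|quad_form M v| <= 2 * entry_sum M * quad_form 1%:M v.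
Proof.
by have := bilin_le M v v; rewrite -mulrA mulrCA mulrDr mulr_natl mulr2n mulrDr.
Qed.

Lemma posdef_ge0 m (M : 'M[R]_m) v : sym_posdef M -> 0 <= quad_form M v.
Proof.
move=> [_ M0]; have [->|/M0/ltW //] := eqVneq v 0; by rewrite quad_form_v0.
Qed.

Lemma posdef1 m : sym_posdef (1%:M : 'M[R]_m).
Proof.
split=> [|v v0]; first exact: trmx1.
rewrite lt_def quad_form1_ge0 andbT; apply: contraNneq v0 => v0.
apply/eqP/matrixP => a b; rewrite ord1 mxE; apply/eqP; rewrite -sqrf_eq0.
by rewrite eq_le sqr_ge0 andbT -v0 sqr_le_quad_form1.
Qed.

(** Cauchy-Schwarz in the scalar product of [M]: the discriminant of
    [t |-> quad_form M (u + t v)] is nonpositive. *)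
Lemma bilin_sqr_le m (M : 'M[R]_m) u v : sym_posdef M ->
  bilin M u v ^+ 2 <= quad_form M u * quad_form M v.
Proof.
move=> [Msym M_gt0]; have [->|v0] := eqVneq v 0.
  by rewrite quad_form_v0 mulr0 /bilin mulmx0 mxE expr0n.
have vv := M_gt0 _ v0.
set a := quad_form M v in vv *; set b := bilin M u v.
have : 0 <= quad_form M (a *: u + (- b) *: v).
  exact: posdef_ge0.
rewrite -[quad_form M _]/(bilin M _ _) !bilinDl !bilinDr !bilinZl !bilinZr.
rewrite [bilin M v u]bilinC // -/b.
rewrite -[bilin M u u]/(quad_form M u) -[bilin M v v]/a => h.
rewrite -subr_ge0 -(pmulr_lge0 _ vv); apply: le_trans h _.
by rewrite le_eqVlt; apply/orP; left; apply/eqP; ring.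
Qed.

Lemma posdef_unit m (M : 'M[R]_m) :
  (forall v, v != 0 -> 0 < quad_form M v) -> M \in unitmx.
Proof.
move=> M_gt0; rewrite -row_free_unit -kermx_eq0; apply/eqP/row_matrixP => a.
rewrite row0; apply/eqP; apply: contraT => u0.
have := M_gt0 (row a (kermx M))^T; rewrite trmx_eq0 => /(_ u0).
by rewrite /quad_form trmxK -row_mul mulmx_ker row0 mul0mx mxE ltxx.
Qed.

(** With [w = M^-1 e_a], the coordinate [v_a = e_a^T v] is the scalar product
    of [w] and [v] for [M], so Cauchy-Schwarz bounds its square. *)
Lemma posdef_coercive m (M : 'M[R]_m) : sym_posdef M ->
  exists2 c, 0 < c & forall v, quad_form 1%:M v <= c * quad_form M v.
Proof.
move=> Mpd; have [Msym M_gt0] := Mpd; have Mu := posdef_unit M_gt0.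
pose w a := invmx M *m delta_mx a 0 : 'cV[R]_m.
(* The summand 1 keeps the constant positive in dimension 0. *)
exists (1 + \sum_a quad_form M (w a)) => [|v].
  by rewrite ltr_pwDl // sumr_ge0 // => a _; exact: posdef_ge0.
rewrite mulrDl mul1r ler_wpDl ?posdef_ge0 // quad_form1 mulr_suml ler_sum // => a _.
suff <- : bilin M (w a) v = v a 0 by exact: bilin_sqr_le.
rewrite /bilin /w trmx_mul trmx_inv Msym -mulmxA -mulmxA mulKmx //.
by rewrite trmx_delta -rowE mxE.
Qed.

Lemma fin_family_bounded (I : finType) (c : I -> R) : (forall i, 0 <= c i) ->
  exists2 C, 0 <= C & forall i, c i <= C.
Proof.
move=> c0; exists (\sum_i c i) => [|i]; first exact: sumr_ge0.
by rewrite (bigD1 i) //= lerDl sumr_ge0.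
Qed.

Lemma bilin_family_le (n m m' : nat) (M : 'I_n -> 'M[R]_(m, m')) :
  exists2 c, 0 <= c & forall i u w,
    `|bilin (M i) u w| <= c * (quad_form 1%:M u + quad_form 1%:M w).
Proof.
have [c c0 cP] :=
  @fin_family_bounded _ (fun i => entry_sum (M i)) (fun i => entry_sum_ge0 _).
exists c => // i u w; rewrite (le_trans (bilin_le _ _ _)) //.
by rewrite ler_wpM2r // addr_ge0 ?quad_form1_ge0.
Qed.

Lemma posdef_family_coercive n m (W : 'I_n -> 'M[R]_m) :
    (forall i, sym_posdef (W i)) ->
  exists2 c, 0 < c & forall i v, quad_form 1%:M v <= c * quad_form (W i) v.
Proof.
move=> Wpd; have /choice[c cP] : forall j, exists c, 0 < c /\
    forall v, quad_form 1%:M v <= c * quad_form (W j) v.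
  by move=> j; have [c ? ?] := posdef_coercive (Wpd j); exists c.
have [C C0 cC] := @fin_family_bounded _ c (fun j => ltW (proj1 (cP j))).
exists (C + 1) => [|i v]; first by rewrite ltr_wpDl.
rewrite (le_trans (proj2 (cP i) v)) // ler_wpM2r ?posdef_ge0 //.
by rewrite (le_trans (cC i)) // lerDl.
Qed.

Lemma bilin_quad_le m (M : 'M[R]_m) c (v : 'cV[R]_m) :
    (forall u w, `|bilin M u w| <= c * (quad_form 1%:M u + quad_form 1%:M w)) ->
  `|quad_form M v| <= 2 * c * quad_form 1%:M v.
Proof. by move=> /(_ v v); rewrite -[bilin M v v]/(quad_form M v); lra. Qed.

Lemma entry_le_norm m m' (M : 'M[R]_(m, m')) a b : `|M a b| <= `|M|.
Proof.
rewrite [`|M|]mx_normrE.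
exact: (le_bigmax _ (fun ij : 'I_m * 'I_m' => `|M ij.1 ij.2|) (a, b)).
Qed.

(** Polarization: [4 u^T M w] is the difference of the values of the quadratic form
    at [u + w] and at [u - w]. *)
Lemma bilin_polar_le m (M : 'M[R]_m) c u w : M^T = M ->
    (forall v, `|quad_form M v| <= c * quad_form 1%:M v) ->
  `|bilin M u w| <= c * (quad_form 1%:M u + quad_form 1%:M w).
Proof.
move=> Ms Mc; have := Mc (u + w); have := Mc (u + (-1) *: w).
rewrite !quad_form_vD ?trmx1 // !bilinZr !quad_form_vZ !ler_norml.
set a := quad_form M u; set b := quad_form M w; set e := bilin M u w.
set qu := quad_form 1%:M u; set qw := quad_form 1%:M w; set quw := bilin 1%:M u w.
have := quad_form1_ge0 (u + w); have := quad_form1_ge0 (u + (-1) *: w).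
rewrite !quad_form_vD ?trmx1 // !bilinZr !quad_form_vZ -/qu -/qw -/quw.
move=> _ _ /andP[h1 h2] /andP[h3 h4]; apply/andP; split; lra.
Qed.

(** Rescaling [u] to [u / h] before applying the bound in squared norms keeps one
    factor [h], where a direct application would leave a term of order 1. *)
Lemma bilin_scale_le m m' (M : 'M[R]_(m, m')) c h r u w :
    (forall u w, `|bilin M u w| <= c * (quad_form 1%:M u + quad_form 1%:M w)) ->
    0 <= c -> 0 <= h -> quad_form 1%:M u <= h ^+ 2 * r ->
  `|bilin M u w| <= h * (c * (r + quad_form 1%:M w)).
Proof.
move=> Mc c0; rewrite le_eqVlt => /predU1P[<-|h0] ur.
  rewrite mul0r; have -> : u = 0.
    apply/matrixP => a b; rewrite ord1 mxE; apply/eqP; rewrite -sqrf_eq0.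
    rewrite eq_le sqr_ge0 andbT (le_trans (sqr_le_quad_form1 u a)) //.
    by rewrite expr0n mul0r in ur.
  by rewrite /bilin trmx0 !mul0mx mxE normr0.
have -> : u = h *: (h^-1 *: u) by rewrite scalerA mulfV ?scale1r ?gt_eqF.
rewrite bilinZl normrM gtr0_norm // ler_wpM2l ?(ltW h0) //.
apply: le_trans (Mc _ _) _; rewrite ler_wpM2l // lerD2r quad_form_vZ.
by rewrite exprVn ler_pdivrMl // exprn_gt0.
Qed.

Lemma quad_form1_mul_le m m' (M : 'M[R]_(m, m')) c v :
    (forall a b, `|M a b| <= c) ->
  quad_form 1%:M (M *m v) <= 2 * (m * (m' * m'))%:R * c ^+ 2 * quad_form 1%:M v.
Proof.
move=> Mc; rewrite -quad_form_mul mulmx1.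
rewrite (le_trans (ler_norm _)) // (le_trans (quad_form_le _ _)) //.
rewrite ler_wpM2r ?quad_form1_ge0 // -mulrA ler_wpM2l //.
apply: le_trans (_ : \sum_(a < m') \sum_(b < m') \sum_(e < m) c ^+ 2 <= _).
  apply: ler_sum => a _; apply: ler_sum => b _; rewrite mxE.
  apply: le_trans (ler_norm_sum _ _ _) _; apply: ler_sum => e _.
  by rewrite mxE normrM expr2 ler_pM.
by rewrite !sumr_const !card_ord -!mulrnA mulr_natl mulnA.
Qed.

End QuadraticForms.

(** * Limits, traces and sums of matrix entries *)

Section MatrixSums.
Context {R : realType}.

Lemma cvg_fin_sum (I : finType) (f : I -> nat -> R) (l : I -> R) :
  (forall i, f i t @[t --> \oo] --> l i) ->
  \sum_i f i t @[t --> \oo] --> \sum_i l i.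
Proof. by move=> fl; apply: cvg_big => //; exact: add_continuous. Qed.

(** A neighbourhood of a matrix contains a product of neighbourhoods of its finitely
    many entries. *)
Lemma matrix_cvg m m' (f : nat -> 'M[R]_(m, m')) (l : 'M[R]_(m, m')) :
  (forall a b, f t a b @[t --> \oo] --> l a b) -> f @ \oo --> l.
Proof.
move=> fl X [E El EX].
have : \forall t \near \oo, forall ab : 'I_m * 'I_m', E ab.1 ab.2 (f t ab.1 ab.2).
  by apply: filter_forall => -[a b]; exact: fl.
by apply: filterS => t ft; apply: EX => a b; exact: (ft (a, b)).
Qed.

Lemma sum_mul_entries m m' (M N : 'M[R]_(m, m')) :
  \sum_a \sum_b M a b * N a b = \tr (M^T *m N).
Proof.
rewrite exchange_big; apply: eq_bigr => b _; rewrite mxE.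
by apply: eq_bigr => a _; rewrite mxE.
Qed.

Lemma trace_delta_mul m m' (M : 'M[R]_(m, m')) a b :
  \tr ((delta_mx a b)^T *m M) = M a b.
Proof.
rewrite -sum_mul_entries -[RHS]bilin_delta bilinE.
by do 2 (apply: eq_bigr => ? _); rewrite !mxE eqxx !andbT -natrM mulnb mulrC.
Qed.

Lemma entry_sum_continuous m m' (G : 'M[R]_(m, m')) :
  continuous (fun M : 'M[R]_(m, m') => \sum_a \sum_b M a b * G a b).
Proof.
move=> M.
apply: (@cvg_big _ _ _ _ _ _ _ (nbhs M)) => [|a _]; first exact: add_continuous.
apply: (@cvg_big _ _ _ _ _ _ _ (nbhs M)) => [|b _]; first exact: add_continuous.
by apply: (@cvgMl _ _ (nbhs M)); exact: coord_continuous.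
Qed.

Lemma sum_at_mode n d (i : 'I_n) (N : 'M[R]_d) (M : 'I_n -> 'M[R]_d) :
  \sum_j \sum_a \sum_b ((j == i)%:R *: N) a b * M j a b
  = \sum_a \sum_b N a b * M i a b.
Proof.
rewrite (bigD1 i) //= [X in _ + X]big1 ?addr0 => [|j /negPf ji].
  by rewrite eqxx scale1r.
rewrite big1 // => a _; rewrite big1 // => b _.
by rewrite ji scale0r mxE mul0r.
Qed.

End MatrixSums.

(** * The Lyapunov operator of a Markovian jump linear system *)

Section LyapunovOperator.
Context {R : realType} {n d : nat}.
Variables (p : 'M[R]_n).
Hypothesis p_stochastic : stochastic p.
Implicit Types (F Z W Y : 'I_n -> 'M[R]_d).

(** The adjoint of the one-step map of the second moments
    [X_j |-> \sum_i p_ij F_i X_i F_i^T]. *)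
Definition lyap_op F Z (i : 'I_n) : 'M[R]_d :=
  (F i)^T *m mode_mean p Z i *m F i.

(** [quad_form (iter t (lyap_op F) (fun=> 1%:M) i) v] is the mean of the squared norm
    of the state at time [t] when the system starts at [v] in mode [i]. *)
Definition lyap_stable F : Prop := forall i v,
  quad_form (iter t (lyap_op F) (fun=> 1%:M) i) v @[t --> \oo] --> 0.

Lemma bilin_lyap F Z i u v :
  bilin (lyap_op F Z i) u v = \sum_j p i j * bilin (Z j) (F i *m u) (F i *m v).
Proof.
rewrite bilin_mul bilin_sum; apply: eq_bigr => j _; exact: bilinZ.
Qed.

Lemma quad_form_lyap F Z i v :
  quad_form (lyap_op F Z i) v = \sum_j p i j * quad_form (Z j) (F i *m v).
Proof. exact: bilin_lyap. Qed.

Lemma lyap_opD F Z Y : lyap_op F (Z \+ Y) = lyap_op F Z \+ lyap_op F Y.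
Proof.
apply/funext => i; rewrite /lyap_op /= -mulmxDl -mulmxDr -big_split /=.
by congr (_ *m _ *m _); apply: eq_bigr => j _; rewrite scalerDr.
Qed.

Lemma lyap_opZ F a Z : lyap_op F (a \*: Z) = a \*: lyap_op F Z.
Proof.
apply/funext => i; rewrite /lyap_op /= scalemxAl scalemxAr scaler_sumr /=.
by congr (_ *m _ *m _); apply: eq_bigr => j _; rewrite /= scalerA mulrC -scalerA.
Qed.

Lemma lyap_op_tr F Z i : (lyap_op F Z i)^T = lyap_op F (fun j => (Z j)^T) i.
Proof.
rewrite /lyap_op !trmx_mul trmxK mulmxA linear_sum /=.
by congr (_ *m _ *m _); apply: eq_bigr => j _; rewrite linearZ.
Qed.

Lemma lyap_mono F Z Y :
    (forall i v, quad_form (Z i) v <= quad_form (Y i) v) ->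
  forall i v, quad_form (lyap_op F Z i) v <= quad_form (lyap_op F Y i) v.
Proof.
move=> ZY i v; rewrite !quad_form_lyap ler_sum // => j _.
by rewrite ler_wpM2l //; case: p_stochastic.
Qed.

Lemma iter_lyap_mono F Z Y :
    (forall i v, quad_form (Z i) v <= quad_form (Y i) v) ->
  forall t i v,
    quad_form (iter t (lyap_op F) Z i) v <= quad_form (iter t (lyap_op F) Y i) v.
Proof. by move=> ZY; elim=> //= t IH; exact: lyap_mono. Qed.

Lemma iter_lyap_ge0 F Z : (forall i v, 0 <= quad_form (Z i) v) ->
  forall t i v, 0 <= quad_form (iter t (lyap_op F) Z i) v.
Proof.
move=> Z0; elim=> // t IH i v; rewrite iterS quad_form_lyap sumr_ge0 // => j _.
by rewrite mulr_ge0 //; case: p_stochastic.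
Qed.

(** The bound passes from [Z] to its iterates because the identity is iterated along
    with it.  It is a bound on the bilinear form, not only on the quadratic one, so
    that nonsymmetric families are covered and uniqueness below holds among all
    families. *)
Lemma iter_lyap_bilin_le F Z c :
    (forall i u v, `|bilin (Z i) u v| <=
       c * (quad_form 1%:M u + quad_form 1%:M v)) ->
  forall t i u v, `|bilin (iter t (lyap_op F) Z i) u v| <=
    c * (quad_form (iter t (lyap_op F) (fun=> 1%:M) i) u
         + quad_form (iter t (lyap_op F) (fun=> 1%:M) i) v).
Proof.
move=> Zc; elim=> [|t IH] i u v; first exact: Zc.
rewrite !iterS bilin_lyap !quad_form_lyap -big_split /= mulr_sumr.
rewrite (le_trans (ler_norm_sum _ _ _)) // ler_sum // => j _.
have p0 : 0 <= p i j by case: p_stochastic.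
by rewrite normrM (ger0_norm p0) -mulrDr mulrCA ler_wpM2l.
Qed.

Lemma iter_lyap_cvg0 F Z i u v : lyap_stable F ->
  bilin (iter t (lyap_op F) Z i) u v @[t --> \oo] --> 0.
Proof.
move=> Fst; pose c := \sum_j entry_sum (Z j).
have Zc j x y : `|bilin (Z j) x y| <= c * (quad_form 1%:M x + quad_form 1%:M y).
  rewrite (le_trans (bilin_le _ _ _)) // ler_wpM2r ?addr_ge0 ?quad_form1_ge0 //.
  by rewrite /c (bigD1 j) //= lerDl sumr_ge0 // => l _; exact: entry_sum_ge0.
have h : c * (quad_form (iter t (lyap_op F) (fun=> 1%:M) i) u
    + quad_form (iter t (lyap_op F) (fun=> 1%:M) i) v) @[t --> \oo] --> c * (0 + 0).
  by apply: cvgMr; apply: cvgD; exact: Fst.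
rewrite addr0 mulr0 in h.
apply: norm_cvg0; apply: squeeze_cvgr (cvg_cst 0) h.
by apply: nearW => t; rewrite normr_ge0 iter_lyap_bilin_le.
Unshelve. all: by end_near. Qed.

(** A fixed point equals all its iterates, which tend to 0. *)
Lemma lyap_fix0 F Z : lyap_stable F -> lyap_op F Z = Z -> Z = fun=> 0.
Proof.
move=> Fst FZ; apply/funext => i; apply: bilin_eq0 => u v.
have itZ t : iter t (lyap_op F) Z = Z by elim: t => //= t ->.
have := iter_lyap_cvg0 Z i u v Fst; under eq_fun do rewrite itZ.
by move/cvg_lim => <- //; rewrite lim_cst.
Qed.

(** [Z |-> Z - lyap_op F Z] has trivial kernel on a finite-dimensional space,
    hence is onto. *)
Lemma lyap_solve F W : lyap_stable F ->
  exists Z, forall i, Z i = W i + lyap_op F Z i.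
Proof.
move=> Fst.
pose f (Z : {ffun 'I_n -> 'M[R]_d}) : {ffun 'I_n -> 'M[R]_d} :=
  [ffun i => Z i - lyap_op F Z i].
have flin : linear f.
  move=> a Z Y; apply/ffunP => i; rewrite !ffunE.
  have -> : lyap_op F (a *: Z + Y) = lyap_op F (a \*: Z \+ Y).
    by congr (lyap_op F); apply/funext => j; rewrite !ffunE.
  by rewrite lyap_opD lyap_opZ /= scalerBr opprD addrACA.
pose g : {linear {ffun 'I_n -> 'M[R]_d} -> {ffun 'I_n -> 'M[R]_d}} :=
  HB.pack f (GRing.isLinear.Build _ _ _ _ f flin).
have /lker0_limgf gfull : lker (linfun g) == 0%VS.
  apply/eqP/vspaceP => Z; rewrite memv0 memv_ker lfunE /=.
  apply/eqP/eqP => [gZ|->]; last first.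
    by rewrite -[f 0]/(g 0) linear0.
  apply/ffunP => i; rewrite ffunE; apply: (congr1 (fun Y => Y i)).
  apply: (lyap_fix0 Fst); apply/funext => j; apply/esym/eqP.
  by rewrite -subr_eq0; move/ffunP: gZ => /(_ j); rewrite !ffunE => ->.
have : [ffun i => W i] \in limg (linfun g) by rewrite gfull memvf.
case/memv_imgP => Z _ /ffunP WZ; exists Z => i.
by have := WZ i; rewrite lfunE /= !ffunE => ->; rewrite subrK.
Qed.

Lemma lyap_unique F W Z Y : lyap_stable F ->
  (forall i, Z i = W i + lyap_op F Z i) ->
  (forall i, Y i = W i + lyap_op F Y i) -> Z = Y.
Proof.
move=> Fst HZ HY; suff : Z \- Y = fun=> 0.
  by move=> /funeqP h; apply/funext => i; apply/eqP; rewrite -subr_eq0; apply/eqP/h.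
apply: (lyap_fix0 Fst); apply/funext => i.
have -> : Z \- Y = Z \+ (-1) \*: Y by apply/funext => j /=; rewrite scaleN1r.
rewrite lyap_opD lyap_opZ /= [in RHS]HZ [in RHS]HY.
by rewrite !scaleN1r opprD addrACA subrr add0r.
Qed.

(** With [T] for [lyap_op F], iterating the hypothesis gives [Y >= T^t Y], and
    [T^t Y] tends to 0. *)
Lemma lyap_ge0 F Y : lyap_stable F ->
    (forall i v, quad_form (lyap_op F Y i) v <= quad_form (Y i) v) ->
  forall i v, 0 <= quad_form (Y i) v.
Proof.
move=> Fst FY i v.
have itY t : quad_form (iter t (lyap_op F) Y i) v <= quad_form (Y i) v.
  elim: t i v => //= t IH i v; apply: le_trans (FY i v).
  exact: lyap_mono.
have := iter_lyap_cvg0 Y i v v Fst; move=> cv.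
rewrite -(cvg_lim _ cv) //; apply: limr_le; first by apply/cvg_ex; exists 0.
exact: nearW.
Qed.

(** Lyapunov's criterion.  With [T] for [lyap_op F], the sums
    [W + T W + ... + T^(t-1) W] stay below [P - T^t P <= P], hence their terms tend to
    0; so do the iterates of the identity, which is dominated by a multiple of the
    definite [W]. *)
Lemma lyap_criterion F P W :
    (forall i, sym_posdef (W i)) ->
    (forall i v, 0 <= quad_form (P i) v) ->
    (forall i v, quad_form (lyap_op F P i) v
                 <= quad_form (P i) v - quad_form (W i) v) ->
  lyap_stable F.
Proof.
move=> Wpd P0 FP i v.
have W0 j x : 0 <= quad_form (W j) x by exact: posdef_ge0.
have itP t j x : quad_form (iter t.+1 (lyap_op F) P j) x <=
    quad_form (iter t (lyap_op F) P j) x - quad_form (iter t (lyap_op F) W j) x.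
  elim: t j x => [|t IH] j x; first exact: FP.
  rewrite -quad_formB iterS.
  have -> : iter t.+1 (lyap_op F) P j - iter t.+1 (lyap_op F) W j =
     lyap_op F (iter t (lyap_op F) P \- iter t (lyap_op F) W) j.
    have -> : iter t (lyap_op F) P \- iter t (lyap_op F) W =
      iter t (lyap_op F) P \+ (-1) \*: iter t (lyap_op F) W.
      by apply/funext => l /=; rewrite scaleN1r.
    by rewrite lyap_opD lyap_opZ /= scaleN1r.
  by apply: lyap_mono => l y; rewrite quad_formB.
pose w t := quad_form (iter t (lyap_op F) W i) v.
have w0 t : 0 <= w t by exact: iter_lyap_ge0.
have sw t : series w t <= quad_form (P i) v - quad_form (iter t (lyap_op F) P i) v.
  elim: t => [|t IH]; first by rewrite /series /= big_geq // subrr.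
  by rewrite seriesSr; have := itP t i v; rewrite -/(w t); lra.
have cw : w @ \oo --> 0.
  apply: cvg_series_cvg_0; apply: nondecreasing_is_cvgn.
    by apply/nondecreasing_seqP => t; rewrite seriesSr lerDl.
  exists (quad_form (P i) v) => _ [t _ <-]; apply: le_trans (sw t) _.
  by rewrite gerBl iter_lyap_ge0.
have [c /ltW c0 cW] := posdef_family_coercive Wpd.
have it1 t : quad_form (iter t (lyap_op F) (fun=> 1%:M) i) v <= c * w t.
  rewrite /w -quad_formZ.
  have -> : c *: iter t (lyap_op F) W i = iter t (lyap_op F) (c \*: W) i.
    elim: t (i) => //= t IH j.
    rewrite -[LHS]/((c \*: lyap_op F (iter t (lyap_op F) W)) j) -lyap_opZ.
    by congr lyap_op; apply/funext => l; exact: IH.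
  by apply: iter_lyap_mono => j x; rewrite quad_formZ.
apply: (@squeeze_cvgr _ _ _ _ (cst 0) (fun t => c * w t)).
- apply: nearW => t; rewrite it1 andbT.
  apply: iter_lyap_ge0 => j x; exact: quad_form1_ge0.
- exact: cvg_cst.
- have h : (c * w t) @[t --> \oo] --> c * 0 by apply: cvgMr.
  by rewrite mulr0 in h.
Unshelve. all: by end_near. Qed.

Lemma lyap_sol_tr (G W Z : 'I_n -> 'M[R]_d) : lyap_stable G ->
    (forall i, Z i = W i + lyap_op G Z i) -> (forall i, (W i)^T = W i) ->
  forall i, (Z i)^T = Z i.
Proof.
move=> st ZW Ws i.
have ZtW j : (Z j)^T = W j + lyap_op G (fun l => (Z l)^T) j.
  by rewrite {1}ZW linearD /= Ws lyap_op_tr.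
by rewrite -[LHS]/((fun l => (Z l)^T) i) (lyap_unique st ZtW ZW).
Qed.

(** The difference of the two solutions solves the equation whose source is
    [W' - W], and [lyap_ge0] applies to it. *)
Lemma lyap_sol_le (G W Z W' Z' : 'I_n -> 'M[R]_d) : lyap_stable G ->
    (forall i, Z i = W i + lyap_op G Z i) ->
    (forall i, Z' i = W' i + lyap_op G Z' i) ->
    (forall i v, quad_form (W i) v <= quad_form (W' i) v) ->
  forall i v, quad_form (Z i) v <= quad_form (Z' i) v.
Proof.
move=> st ZW ZW' WW' i v; rewrite -subr_ge0 -quad_formB.
have := @lyap_ge0 G (Z' \+ (-1) \*: Z) st _ i v.
rewrite /= scaleN1r; apply => j w.
rewrite lyap_opD lyap_opZ /= !quad_formD !quad_formZ [in leRHS]ZW [in leRHS]ZW'.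
by rewrite !quad_formD; have := WW' j w; lra.
Qed.

End LyapunovOperator.

(** * Means of real functions and independence *)

Section HasMean.
Context {R : realType} {dT : measure_display} {T : measurableType dT}.
Variable P : probability T R.
Implicit Types (f g : T -> R) (H : set T).

(** Integrability and the value of the integral are carried together, so that linear
    combinations need no separate integrability proofs. *)
Definition has_mean f (m : R) : Prop :=
  P.-integrable [set: T] (EFin \o f) /\ (\int[P]_w (f w)%:E = m%:E)%E.

Lemma has_mean_expectation f m : has_mean f m -> ('E_P[f] = m%:E)%E.
Proof. by case=> _ <-; rewrite unlock. Qed.

Lemma has_mean_unique f m m' : has_mean f m -> has_mean f m' -> m = m'.
Proof. by move=> [_ fm] [_]; rewrite fm => -[]. Qed.

Lemma has_mean_integrable f : P.-integrable [set: T] (EFin \o f) ->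
  has_mean f (fine (\int[P]_w (f w)%:E)).
Proof. by move=> fi; split=> //; rewrite fineK //; exact: integrable_fin_num. Qed.

Lemma has_meanZ a f m : has_mean f m -> has_mean (fun w => a * f w) (a * m).
Proof.
move=> [fi fm]; split; first exact: (integrableZl measurableT a fi).
by rewrite EFinM -fm -(integralZl measurableT fi).
Qed.

Lemma has_meanD f g m m' : has_mean f m -> has_mean g m' ->
  has_mean (fun w => f w + g w) (m + m').
Proof.
move=> [fi fm] [gi gm]; split; first exact: (integrableD measurableT fi gi).
by rewrite EFinD -fm -gm -(integralD measurableT fi gi).
Qed.

Lemma has_mean_sum (I : finType) (f : I -> T -> R) (m : I -> R) :
  (forall i, has_mean (f i) (m i)) ->
  has_mean (fun w => \sum_i f i w) (\sum_i m i).
Proof.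
move=> fm; have fi i : P.-integrable [set: T] (EFin \o f i) by case: (fm i).
have E : EFin \o (fun w => \sum_i f i w) = fun w => (\sum_i (EFin \o f i) w)%E.
  by apply/funext => w /=; rewrite sumEFin.
split; first by rewrite E; apply: integrable_sum => // i _.
transitivity (\int[P]_w (\sum_i (EFin \o f i) w)%E)%E.
  by apply: eq_integral => w _; rewrite sumEFin.
rewrite integral_sum // -sumEFin; apply: eq_bigr => i _; by case: (fm i).
Qed.

Lemma has_mean_ge0 f m : (forall w, 0 <= f w) -> has_mean f m -> 0 <= m.
Proof.
move=> f0 [_ fm]; rewrite -lee_fin -fm; apply: integral_ge0 => w _.
by rewrite lee_fin.
Qed.

(** Both sides are integrals against the law of a real variable: the law of
    [g * \1_H] agrees away from the origin with [P H] times the law of [g]. *)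
Lemma indep_integral_ge0 g H :
    measurable_fun [set: T] g -> (forall w, 0 <= g w) -> measurable H ->
    (forall U, measurable U -> P (g @^-1` U `&` H) = (P (g @^-1` U) * P H)%E) ->
  (\int[P]_w (g w * \1_H w)%:E = P H * \int[P]_w (g w)%:E)%E.
Proof.
move=> mg g0 mH ind.
have mgH : measurable_fun [set: T] (fun w => g w * \1_H w).
  by apply: measurable_funM => //; exact: measurable_indic.
pose X : {RV P >-> R} := HB.pack (fun w => g w * \1_H w : R)
  (isMeasurableFun.Build _ _ _ _ _ mgH).
pose G : {RV P >-> R} := HB.pack g (isMeasurableFun.Build _ _ _ _ _ mg).
pose D : set R := [set~ 0].
pose f (y : R) : \bar R := (`|y|)%:E.
have mf : measurable_fun [set: R] f by apply/measurable_EFinP; exact: normr_measurable.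
have f0 y : (0 <= f y)%E by rewrite lee_fin.
have off0 (nu : {measure set R -> \bar R}) :
    (\int[nu]_y f y = \int[nu]_(y in D) f y)%E.
  rewrite [RHS]integral_mkcond; apply: eq_integral => y _; rewrite patchE.
  case: ifPn => //; rewrite notin_setE /= /D => /contrapT ->; by rewrite /f normr0.
have fPH : P H \is a fin_num by exact: fin_num_measure.
have PH0 : 0 <= fine (P H) by exact: fine_ge0.
have law (Y : {RV P >-> R}) : (forall w, 0 <= Y w) ->
    (\int[P]_w (Y w)%:E = \int[distribution P Y]_(y in D) f y)%E.
  move=> Y0; rewrite -off0 ge0_integral_distribution //.
  by apply: eq_integral => w _; rewrite /f /= ger0_norm.
rewrite (law X); last by move=> w; rewrite mulr_ge0.
rewrite (law G) // -[in RHS](fineK fPH).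
rewrite -[fine (P H)]/((NngNum PH0)%:num) -ge0_integral_mscale //; last 2 first.
  exact: measurableC.
  exact: measurable_funS mf.
apply: eq_measure_integral => U mU U0.
transitivity (P (g @^-1` U `&` H)).
  congr (P _); apply/seteqP; split => w /=.
    have [Hw|Hw] := pselect (H w); first by rewrite indicE mem_set // mulr1.
    by rewrite indicE memNset // mulr0 => /U0 /(_ erefl).
  by move=> [gw Hw]; rewrite indicE mem_set // mulr1.
by rewrite ind // muleC -[in LHS](fineK fPH).
Qed.

End HasMean.

(** * Initial states uncorrelated with the mode histories *)

Section InitialState.
Context {R : realType} {dT : measure_display} {T : measurableType dT}.
Variable P : probability T R.
Context {n d : nat}.
Variables (omega : nat -> T -> 'I_n).
Hypothesis omega_meas : forall t i, measurable (omega t @^-1` [set i]).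

(** The one consequence of the independence of [x0] and the chain on which the moments
    of the closed loop depend.  It is immediate for a deterministic initial state. *)
Definition history_uncorrelated (x0 : T -> 'cV[R]_d) (S : 'M[R]_d) : Prop :=
  forall a b t s,
    has_mean P (fun w => x0 w a 0 * x0 w b 0 * \1_(mode_history omega t s) w)
             (S a b * fine (P (mode_history omega t s))).

Lemma mode_history0 s : mode_history omega 0 s = omega 0%N @^-1` [set s 0%N].
Proof.
apply/seteqP; split => w /=; first by move=> /(_ 0%N); exact.
by move=> h r; rewrite leqn0 => /eqP ->.
Qed.

Lemma mode_historyS t s :
  mode_history omega t.+1 s
  = mode_history omega t s `&` omega t.+1 @^-1` [set s t.+1].
Proof.
apply/seteqP; split => w /=.
  by move=> h; split; [move=> r rt; apply: h; exact: leqW | exact: h].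
by move=> [h1 h2] r; rewrite leq_eqVlt => /predU1P[->//|]; rewrite ltnS; exact: h1.
Qed.

Lemma measurable_mode_history t s : measurable (mode_history omega t s).
Proof.
elim: t => [|t IH]; first by rewrite mode_history0.
by rewrite mode_historyS; exact: measurableI.
Qed.

Lemma sigma_chain_mode_history t s : sigma_chain omega (mode_history omega t s).
Proof.
have gen r i : sigma_chain omega (omega r @^-1` [set i]).
  apply: sub_sigma_algebra; exists r => //; exists [set i] => //.
  by rewrite setTI.
elim: t => [|t IH]; first by rewrite mode_history0.
rewrite mode_historyS; apply: (@measurableI _ (g_sigma_algebraType
  (\bigcup_r preimage_set_system [set: T] (omega r) [set: set 'I_n]))) => //.
exact: gen.
Qed.

Lemma has_mean_indic H : measurable H -> has_mean P \1_H (fine (P H)).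
Proof.
move=> mH; split; first exact: integrable_indic.
by rewrite integral_indic // setIT fineK //; exact: fin_num_measure.
Qed.

Lemma history_uncorrelated_cst (v : 'cV[R]_d) :
  history_uncorrelated (fun=> v) (v *m v^T).
Proof.
move=> a b t s; rewrite !mxE big_ord1 mxE; apply: has_meanZ.
exact/has_mean_indic/measurable_mode_history.
Qed.

Section Random.
Variable x0 : T -> 'cV[R]_d.
Hypotheses (x0_random : random_vector x0) (x0_moment : finite_second_moment P x0).
Hypothesis x0_indep : independent_of_chain P x0 omega.

Lemma integrable_mul_coord a b :
  P.-integrable [set: T] (EFin \o (fun w => x0 w a 0 * x0 w b 0)).
Proof.
have mM (c e : 'I_d) : measurable_fun [set: T] (fun w => x0 w c 0 * x0 w e 0).
  exact: measurable_funM.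
have mE : measurable_fun [set: T] (fun w => euclid_norm (x0 w) ^+ 2).
  under eq_fun do rewrite euclid_normE quad_form1.
  by apply: measurable_sum => c; under eq_fun do rewrite expr2; exact: mM.
have iE : P.-integrable [set: T] (EFin \o (fun w => euclid_norm (x0 w) ^+ 2)).
  apply/integrableP; split; first exact/measurable_EFinP.
  move: x0_moment; rewrite /finite_second_moment unlock => /(le_lt_trans _); apply.
  rewrite le_eqVlt; apply/orP; left; apply/eqP; apply: eq_integral => w _ /=.
  by rewrite ger0_norm // sqr_ge0.
apply: (le_integrable _ _ _ (integrableZl measurableT 2 iE)) => //.
  exact/measurable_EFinP.
move=> w _ /=; rewrite lee_fin [leRHS]ger0_norm; last first.
  by rewrite mulr_ge0 ?sqr_ge0.
rewrite (le_trans (normM_le_sqr _ _)) // euclid_normE mulr_natl mulr2n lerD //;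
exact: sqr_le_quad_form1.
Qed.

Lemma sigma_vector_preimage (h : T -> R) :
    measurable_fun (setT : set (g_sigma_algebraType
      (\bigcup_j preimage_set_system [set: T] (fun w => x0 w j 0) measurable))) h ->
  forall U, measurable U -> sigma_vector x0 (h @^-1` U).
Proof. by move=> mh U mU; have := mh measurableT U mU; rewrite setTI. Qed.

(** Independence factors the means of nonnegative functions of [x0], here squares of
    linear forms; the products of two coordinates follow by polarization. *)
Lemma history_uncorrelated_indep :
  history_uncorrelated x0 (second_moment P x0).
Proof.
move=> a b t s; set H := mode_history omega t s.
have mH : measurable H by exact: measurable_mode_history.
pose S := g_sigma_algebraType
  (\bigcup_j preimage_set_system [set: T] (fun w => x0 w j 0) measurable).
have mx j : measurable_fun (setT : set S) (fun w => x0 w j 0).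
  move=> _ U mU; apply: sub_sigma_algebra; exists j => //; by exists U.
have sqr_mean (h : T -> R) m : measurable_fun (setT : set S) h ->
    measurable_fun [set: T] h -> has_mean P (fun w => h w ^+ 2) m ->
    has_mean P (fun w => h w ^+ 2 * \1_H w) (m * fine (P H)).
  move=> mSh mh [hi hm]; split.
    apply: (le_integrable _ _ _ hi) => //.
      apply/measurable_EFinP/measurable_funM; first exact: measurable_funX.
      exact: measurable_indic.
    move=> w _; rewrite /= lee_fin normrM ler_piMr // indicE.
    by case: (w \in H); rewrite ?normr1 ?normr0.
  rewrite indep_integral_ge0 //.
  - by rewrite hm muleC EFinM fineK //; exact: fin_num_measure.
  - exact: measurable_funX.
  - by move=> w; exact: sqr_ge0.
  - move=> U mU; apply: x0_indep; last exact: sigma_chain_mode_history.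
    by apply: sigma_vector_preimage => //; exact: measurable_funX.
have mean c e : has_mean P (fun w => x0 w c 0 * x0 w e 0) (second_moment P x0 c e).
  rewrite mxE unlock.
  under eq_integral do rewrite mxE big_ord1 mxE.
  exact/has_mean_integrable/integrable_mul_coord.
have sqr c : has_mean P (fun w => x0 w c 0 ^+ 2 * \1_H w)
    (second_moment P x0 c c * fine (P H)).
  by apply: sqr_mean => //; under eq_fun do rewrite expr2; exact: mean.
have sqrD : has_mean P (fun w => (x0 w a 0 + x0 w b 0) ^+ 2 * \1_H w)
   ((second_moment P x0 a a + second_moment P x0 b b + 2 * second_moment P x0 a b) * fine (P H)).
  apply: sqr_mean; try exact: measurable_funD.
  have -> : (fun w => (x0 w a 0 + x0 w b 0) ^+ 2) = (fun w =>
     (x0 w a 0 * x0 w a 0 + x0 w b 0 * x0 w b 0) + 2 * (x0 w a 0 * x0 w b 0)).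
    by apply/funext => w; ring.
  by apply: has_meanD; [apply: has_meanD | apply: has_meanZ].
have -> : (fun w => x0 w a 0 * x0 w b 0 * \1_H w) = (fun w =>
    2^-1 * ((x0 w a 0 + x0 w b 0) ^+ 2 * \1_H w
     + -1 * (x0 w a 0 ^+ 2 * \1_H w + x0 w b 0 ^+ 2 * \1_H w))).
  by apply/funext => w; field.
have -> : second_moment P x0 a b * fine (P H) = 2^-1 *
   ((second_moment P x0 a a + second_moment P x0 b b + 2 * second_moment P x0 a b) * fine (P H)
    + -1 * (second_moment P x0 a a * fine (P H) + second_moment P x0 b b * fine (P H))).
  by field.
by apply: has_meanZ; apply: has_meanD => //; apply: has_meanZ; exact: has_meanD.
Qed.

End Random.
End InitialState.

(** * Second moments along the closed loop *)

Section StateMoments.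
Context {R : realType} {dT : measure_display} {T : measurableType dT}.
Variable P : probability T R.
Context {n d k : nat}.
Variables (A : 'I_n -> 'M[R]_d) (B : 'I_n -> 'M[R]_(d, k)) (p : 'M[R]_n).
Variables (mu : 'I_n -> R) (omega : nat -> T -> 'I_n) (x0 : T -> 'cV[R]_d).
Variables (S : 'M[R]_d) (K : @policy R n d k).
Hypothesis omega_markov : markov_chain P p mu omega.
Hypothesis x0_hist : history_uncorrelated P omega x0 S.

Definition closed_gain (i : 'I_n) : 'M[R]_d := A i - B i *m gain K i.

Let x := closed_loop A B K omega x0.

Lemma closed_loopS t w :
  x t.+1 w = closed_gain (omega t w) *m x t w.
Proof. by rewrite /x /= /control mulmxN mulmxA mulmxBl. Qed.

Fixpoint transition (s : nat -> 'I_n) (t : nat) : 'M[R]_d :=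
  if t is r.+1 then closed_gain (s r) *m transition s r else 1%:M.

Lemma closed_loop_history t s w : mode_history omega t s w ->
  x t w = transition s t *m x0 w.
Proof.
elim: t => [|t IH] h; first by rewrite mul1mx.
rewrite closed_loopS IH; last by move=> r rt; apply: h; exact: leqW.
by rewrite mulmxA h.
Qed.

Let omega_meas t i : measurable (omega t @^-1` [set i]).
Proof. by case: omega_markov. Qed.

(** Histories up to time [t] are indexed by a finite type, so that functions of the
    state at time [t] decompose into finite sums. *)
Definition extend t (s : {ffun 'I_t.+1 -> 'I_n}) (r : nat) : 'I_n := s (inord r).

Lemma history_partition t (f : R) w :
  f = \sum_(s : {ffun 'I_t.+1 -> 'I_n}) f * \1_(mode_history omega t (extend s)) w.
Proof.
rewrite (bigD1 [ffun r : 'I_t.+1 => omega r w]) //= big1 ?addr0.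
  rewrite indicE mem_set ?mulr1 // => r rt.
  by rewrite /extend ffunE inordK.
move=> s /eqP sw; rewrite indicE memNset ?mulr0 // => h; apply: sw.
by apply/ffunP => r; rewrite ffunE h // /extend ?inord_val // -ltnS.
Qed.

Definition extend_next t (s : {ffun 'I_t.+1 -> 'I_n}) (j : 'I_n) (r : nat) : 'I_n :=
  if (r <= t)%N then extend s r else j.

Lemma mode_history_next t s j :
  mode_history omega t.+1 (@extend_next t s j)
  = mode_history omega t (extend s) `&` omega t.+1 @^-1` [set j].
Proof.
rewrite mode_historyS /extend_next ltnn; congr (_ `&` _).
by apply/seteqP; split => w h r rt; have := h r rt; rewrite rt.
Qed.

Lemma prob_mode_history_next t s j :
  fine (P (mode_history omega t.+1 (@extend_next t s j)))
  = p (s ord_max) j * fine (P (mode_history omega t (extend s))).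
Proof.
have [_ _ ->] := omega_markov.
have -> : mode_history omega t (extend_next s j) = mode_history omega t (extend s).
  by apply/seteqP; split => w h r rt; have := h r rt; rewrite /extend_next rt.
rewrite fineM //; last by apply: fin_num_measure; exact: measurable_mode_history.
rewrite mulrC /= /extend_next leqnn ltnn /extend.
by congr (p (s _) j * _); apply: val_inj; rewrite /= inordK.
Qed.

Lemma has_mean_path (M : 'M[R]_d) a b t s :
  has_mean P (fun w => (M *m x0 w) a 0 * (M *m x0 w) b 0
                       * \1_(mode_history omega t s) w)
    ((M *m S *m M^T) a b * fine (P (mode_history omega t s))).
Proof.
set H := mode_history omega t s.
have -> : (fun w => (M *m x0 w) a 0 * (M *m x0 w) b 0 * \1_H w) =
  (fun w => \sum_c \sum_e (M a c * M b e) * (x0 w c 0 * x0 w e 0 * \1_H w)).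
  apply/funext => w; rewrite !mxE big_distrlr /= mulr_suml.
  by apply: eq_bigr => c _; rewrite mulr_suml; apply: eq_bigr => e _; ring.
have -> : (M *m S *m M^T) a b * fine (P H) =
    \sum_c \sum_e (M a c * M b e) * (S c e * fine (P H)).
  rewrite mxE mulr_suml exchange_big /=; apply: eq_bigr => e _.
  rewrite !mxE !mulr_suml; apply: eq_bigr => c _; ring.
by do 2 (apply: has_mean_sum => ?); apply: has_meanZ; exact: x0_hist.
Qed.

(** On each of the finitely many histories up to time [t] the state is a fixed matrix
    times [x0], and the history and [x0] are uncorrelated.  Appending [j] to a history
    that ends in [i] multiplies its probability by [p i j], whence the second part. *)
Lemma has_mean_mode t i a b : exists m : R,
  has_mean P (fun w => x t w a 0 * x t w b 0 * \1_(omega t @^-1` [set i]) w) m /\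
  forall j, has_mean P (fun w => x t w a 0 * x t w b 0
      * \1_(omega t @^-1` [set i]) w * \1_(omega t.+1 @^-1` [set j]) w) (p i j * m).
Proof.
pose M s := transition (@extend t s) t.
exists (\sum_(s : {ffun 'I_t.+1 -> 'I_n}) (s ord_max == i)%:R *
  ((M s *m S *m (M s)^T) a b * fine (P (mode_history omega t (extend s))))).
have onH w s : mode_history omega t (@extend t s) w ->
    x t w a 0 * x t w b 0 * \1_(omega t @^-1` [set i]) w =
    (s ord_max == i)%:R * ((M s *m x0 w) a 0 * (M s *m x0 w) b 0).
  move=> h; rewrite (closed_loop_history h) mulrC; congr (_ * _).
  have -> : s ord_max = omega t w.
    by rewrite h // /extend; congr (s _); apply: val_inj; rewrite /= inordK.
  rewrite indicE; congr (_%:R); congr nat_of_bool.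
  by apply/idP/eqP; rewrite inE.
split=> [|j].
  have -> : (fun w => x t w a 0 * x t w b 0 * \1_(omega t @^-1` [set i]) w) =
      fun w => \sum_(s : {ffun 'I_t.+1 -> 'I_n}) (s ord_max == i)%:R *
        ((M s *m x0 w) a 0 * (M s *m x0 w) b 0
          * \1_(mode_history omega t (extend s)) w).
    apply/funext => w; rewrite [LHS](history_partition t _ w).
    apply: eq_bigr => s _.
    have [h|h] := pselect (mode_history omega t (extend s) w).
      by rewrite [\1_(mode_history _ _ _) _]indicE mem_set // !mulr1 -(onH w s h).
    by rewrite [\1_(mode_history _ _ _) _]indicE (memNset h) !mulr0.
  by apply: has_mean_sum => s; apply: has_meanZ; exact: has_mean_path.
have -> : (fun w => x t w a 0 * x t w b 0 * \1_(omega t @^-1` [set i]) w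
             * \1_(omega t.+1 @^-1` [set j]) w) =
      fun w => \sum_(s : {ffun 'I_t.+1 -> 'I_n}) (s ord_max == i)%:R *
        ((M s *m x0 w) a 0 * (M s *m x0 w) b 0
          * \1_(mode_history omega t.+1 (extend_next s j)) w).
  apply/funext => w; rewrite [LHS](history_partition t _ w).
  apply: eq_bigr => s _; rewrite mode_history_next indicI /= mulrAC.
  have [h|h] := pselect (mode_history omega t (extend s) w).
    by rewrite [\1_(mode_history _ _ _) _]indicE mem_set // mulr1 mul1r mulrA -(onH w s h).
  by rewrite [\1_(mode_history _ _ _) _]indicE (memNset h) !(mul0r, mulr0).
rewrite mulr_sumr; apply: has_mean_sum => s.
have -> : p i j * ((s ord_max == i)%:R * ((M s *m S *m (M s)^T) a b *
     fine (P (mode_history omega t (extend s))))) = (s ord_max == i)%:R *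
     ((M s *m S *m (M s)^T) a b * fine (P (mode_history omega t.+1 (extend_next s j)))).
  rewrite prob_mode_history_next; have [->|_] := eqVneq (s ord_max) i.
    by rewrite !mul1r mulrCA.
  by rewrite !mul0r mulr0.
by apply: has_meanZ; exact: has_mean_path.
Qed.

Let M := mode_moment A B P omega x0 K.

Lemma has_mean_mode_moment t i a b :
  has_mean P (fun w => x t w a 0 * x t w b 0 * \1_(omega t @^-1` [set i]) w)
    (M i t a b).
Proof.
have [m [hm _]] := has_mean_mode t i a b.
suff -> : M i t a b = m by [].
rewrite mxE -[RHS]/(fine m%:E) -(has_mean_expectation hm).
by congr (fine (expectation _ _)); apply/funext => w /=; rewrite mxE big_ord1 mxE.
Qed.

Lemma has_mean_mode_moment_next t i j a b :
  has_mean P (fun w => x t w a 0 * x t w b 0 * \1_(omega t @^-1` [set i]) w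
                       * \1_(omega t.+1 @^-1` [set j]) w) (p i j * M i t a b).
Proof.
have [m [hm hj]] := has_mean_mode t i a b.
by rewrite (has_mean_unique (has_mean_mode_moment t i a b) hm).
Qed.

(** This is the mean of [x_t^T Z_(omega t) x_t] (see [has_mean_moment_value]), written
    through the mode moments. *)
Definition moment_value (t : nat) (Z : 'I_n -> 'M[R]_d) : R :=
  \sum_i \sum_a \sum_b Z i a b * M i t a b.

Lemma sum_indic_mode t (f : 'I_n -> R) w :
  f (omega t w) = \sum_i f i * \1_(omega t @^-1` [set i]) w.
Proof.
rewrite (bigD1 (omega t w)) //= big1 ?addr0 => [|i iw].
  by rewrite indicE mem_set ?mulr1.
by rewrite indicE memNset ?mulr0 //= => wi; rewrite wi eqxx in iw.
Qed.

Lemma has_mean_moment_value t (Z : 'I_n -> 'M[R]_d) :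
  has_mean P (fun w => quad_form (Z (omega t w)) (x t w)) (moment_value t Z).
Proof.
have -> : (fun w => quad_form (Z (omega t w)) (x t w)) =
    fun w => \sum_i \sum_a \sum_b Z i a b *
      (x t w a 0 * x t w b 0 * \1_(omega t @^-1` [set i]) w).
  apply/funext => w.
  rewrite (sum_indic_mode t (fun i => quad_form (Z i) (x t w))).
  apply: eq_bigr => i _; rewrite -[quad_form _ _]/(bilin _ _ _) bilinE mulr_suml.
  by apply: eq_bigr => a _; rewrite mulr_suml; apply: eq_bigr => b _; ring.
by do 3 (apply: has_mean_sum => ?); apply: has_meanZ; exact: has_mean_mode_moment.
Qed.

(** Conditionally on the modes up to time [t], the next one is drawn from the row of
    [p] at the current mode. *)
Lemma moment_valueS t (Z : 'I_n -> 'M[R]_d) :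
  moment_value t.+1 Z = moment_value t (lyap_op p closed_gain Z).
Proof.
apply: has_mean_unique (has_mean_moment_value t.+1 Z) _.
pose G i j : 'M[R]_d := (closed_gain i)^T *m Z j *m closed_gain i.
have -> : moment_value t (lyap_op p closed_gain Z) =
    \sum_i \sum_j \sum_a \sum_b G i j a b * (p i j * M i t a b).
  apply: eq_bigr => i _.
  rewrite [RHS]exchange_big /=; apply: eq_bigr => a _.
  rewrite [RHS]exchange_big /=; apply: eq_bigr => b _.
  have -> : lyap_op p closed_gain Z i = \sum_j p i j *: G i j.
    rewrite /lyap_op /mode_mean mulmx_sumr mulmx_suml.
    by apply: eq_bigr => j _; rewrite -scalemxAr -scalemxAl.
  by rewrite summxE mulr_suml; apply: eq_bigr => j _; rewrite mxE; ring.
have -> : (fun w => quad_form (Z (omega t.+1 w)) (x t.+1 w)) =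
    fun w => \sum_i \sum_j \sum_a \sum_b G i j a b *
      (x t w a 0 * x t w b 0 * \1_(omega t @^-1` [set i]) w
        * \1_(omega t.+1 @^-1` [set j]) w).
  apply/funext => w; rewrite closed_loopS -quad_form_mul -/(G _ _).
  rewrite (sum_indic_mode t (fun i => quad_form (G i (omega t.+1 w)) (x t w))).
  apply: eq_bigr => i _.
  rewrite (sum_indic_mode t.+1 (fun j => quad_form (G i j) (x t w))) mulr_suml.
  apply: eq_bigr => j _; rewrite -[quad_form _ _]/(bilin _ _ _) bilinE !mulr_suml.
  by apply: eq_bigr => a _; rewrite !mulr_suml; apply: eq_bigr => b _; ring.
by do 4 (apply: has_mean_sum => ?); apply: has_meanZ; exact: has_mean_mode_moment_next.
Qed.

Lemma moment_value_iter t (Z : 'I_n -> 'M[R]_d) :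
  moment_value t Z = moment_value 0 (iter t (lyap_op p closed_gain) Z).
Proof. by elim: t Z => // t IH Z; rewrite moment_valueS IH iterSr. Qed.

Lemma mode_moment0 i : M i 0%N = mu i *: S.
Proof.
apply/matrixP => a b; apply: has_mean_unique (has_mean_mode_moment 0 i a b) _.
have := x0_hist a b 0%N (fun=> i); rewrite mode_history0.
by have [_ -> _] := omega_markov; rewrite /= mulrC mxE.
Qed.

Lemma moment_valueD t Z Y : moment_value t (Z \+ Y) = moment_value t Z + moment_value t Y.
Proof.
rewrite /moment_value -big_split /=; apply: eq_bigr => i _.
rewrite -big_split /=; apply: eq_bigr => a _.
by rewrite -big_split /=; apply: eq_bigr => b _; rewrite mxE mulrDl.
Qed.

Lemma moment_value_ge0 t Z : (forall i v, 0 <= quad_form (Z i) v) ->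
  0 <= moment_value t Z.
Proof. by move=> Z0; apply: has_mean_ge0 (has_mean_moment_value t Z) => w. Qed.

End StateMoments.

(** * Mean-square stability in terms of the Lyapunov operator *)

Section MeanSquareStability.
Context {R : realType} {n d k : nat}.
Variables (A : 'I_n -> 'M[R]_d) (B : 'I_n -> 'M[R]_(d, k)) (p : 'M[R]_n).
Hypothesis p_stochastic : stochastic p.
Variable K : @policy R n d k.
Let F := closed_gain A B K.

Section FixedInitialState.
Context {dT : measure_display} {T : measurableType dT} (P : probability T R).
Variables (mu : 'I_n -> R) (omega : nat -> T -> 'I_n) (v : 'cV[R]_d).
Hypothesis omega_markov : markov_chain P p mu omega.

Lemma mean_sqr_state t :
  ('E_P[fun w => (euclid_norm (closed_loop A B K omega (fun=> v) t w) ^+ 2)%R]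
   = (\sum_i mu i * quad_form (iter t (lyap_op p F) (fun=> 1%:M) i) v)%:E)%E.
Proof.
have omega_meas t' i : measurable (omega t' @^-1` [set i]) by case: omega_markov.
have hist := history_uncorrelated_cst P omega_meas v.
under [X in expectation _ X]eq_fun do rewrite euclid_normE.
rewrite (has_mean_expectation
  (has_mean_moment_value A B K omega_markov hist t (fun=> 1%:M))).
rewrite (moment_value_iter A B K omega_markov hist); congr EFin.
apply: eq_bigr => i _; rewrite (mode_moment0 A B K omega_markov hist).
rewrite -[quad_form _ _]/(bilin _ _ _) bilinE mulr_sumr; apply: eq_bigr => a _.
by rewrite mulr_sumr; apply: eq_bigr => b _; rewrite !mxE big_ord1 mxE; ring.
Qed.

End FixedInitialState.

(** The mean squared norm is a combination, with the positive weights [mu], of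
    nonnegative terms, so all of them tend to 0 with it.  A single chain that charges
    every mode therefore suffices. *)
Lemma ms_stabilizing_lyap_stable (dT : measure_display) (T : measurableType dT)
    (P : probability T R) (mu : 'I_n -> R) (omega : nat -> T -> 'I_n) :
    markov_chain P p mu omega -> (forall i, 0 < mu i) ->
  ms_stabilizing A B p K -> lyap_stable p F.
Proof.
move=> om mu0 st i v.
have := st _ _ P mu omega v om; under eq_fun do rewrite (mean_sqr_state v om).
move=> /fine_cvgP[_ /= h].
have q0 t j : 0 <= quad_form (iter t (lyap_op p F) (fun=> 1%:M) j) v.
  by apply: iter_lyap_ge0 => // l y; exact: quad_form1_ge0.
have : (mu i)^-1 * (\sum_j mu j * quad_form (iter t (lyap_op p F) (fun=> 1%:M) j) v)
    @[t --> \oo] --> (mu i)^-1 * 0 by apply: cvgMr.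
rewrite mulr0 => h'; apply: squeeze_cvgr (cvg_cst 0) h'; apply: nearW => t.
rewrite q0 /= -ler_pdivrMl ?invr_gt0 // invrK (bigD1 i) //= lerDl.
by apply: sumr_ge0 => j _; rewrite mulr_ge0 // ltW.
Qed.

Lemma lyap_stable_ms_stabilizing : lyap_stable p F -> ms_stabilizing A B p K.
Proof.
move=> st dT T P mu omega v om.
under eq_fun do rewrite (mean_sqr_state v om).
apply: cvg_EFin; first exact: nearW.
have h : (\sum_i mu i * quad_form (iter t (lyap_op p F) (fun=> 1%:M) i) v)
    @[t --> \oo] --> \sum_i mu i * 0.
  by apply: cvg_fin_sum => i; apply: cvgMr; exact: st.
by rewrite big1 in h => // i _; rewrite mulr0.
Qed.

End MeanSquareStability.

(** * The cost and the state Gramian *)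

Section CostAndMoments.
Context {R : realType} {n d k : nat}.
Variables (A : 'I_n -> 'M[R]_d) (B : 'I_n -> 'M[R]_(d, k)) (p : 'M[R]_n).
Variables (Q : 'I_n -> 'M[R]_d) (Rw : 'I_n -> 'M[R]_k).
Hypothesis p_stochastic : stochastic p.
Hypothesis Q_posdef : forall i, sym_posdef (Q i).
Hypothesis Rw_posdef : forall i, sym_posdef (Rw i).
Context {dT : measure_display} {T : measurableType dT} (P : probability T R).
Variables (mu : 'I_n -> R) (omega : nat -> T -> 'I_n) (x0 : T -> 'cV[R]_d).
Variable S : 'M[R]_d.
Hypothesis omega_markov : markov_chain P p mu omega.
Hypothesis x0_hist : history_uncorrelated P omega x0 S.
Variable K : @policy R n d k.
Let F := closed_gain A B K.
Hypothesis Fst : lyap_stable p F.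

Let value := moment_value P A B omega x0 K.

Definition initial_value (Z : 'I_n -> 'M[R]_d) : R :=
  \sum_i \sum_a \sum_b Z i a b * (mu i * S a b).

Lemma moment_value0 Z : value 0 Z = initial_value Z.
Proof.
apply: eq_bigr => i _; apply: eq_bigr => a _; apply: eq_bigr => b _.
by rewrite (mode_moment0 A B K omega_markov x0_hist) mxE.
Qed.

Let valueS t Z : value t.+1 Z = value t (lyap_op p F Z).
Proof. exact: (moment_valueS A B K omega_markov x0_hist). Qed.

Let value_iter t Z : value t Z = initial_value (iter t (lyap_op p F) Z).
Proof.
by rewrite -moment_value0; exact: (moment_value_iter A B K omega_markov x0_hist).
Qed.

(** The values of [W] along the trajectory telescope, because
    [W = Z - lyap_op p F Z] and the value of [lyap_op p F Z] at time [t] is that of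
    [Z] at time [t + 1]. *)
Lemma series_value (W Z : 'I_n -> 'M[R]_d) : (forall i, Z i = W i + lyap_op p F Z i) ->
  series (value^~ W) t @[t --> \oo] --> initial_value Z.
Proof.
move=> ZW.
have E t : series (value^~ W) t = initial_value Z - value t Z.
  elim: t => [|t IH]; first by rewrite moment_value0 subrr /series /= big_geq.
  rewrite seriesSr IH valueS.
  have -> : value t Z = value t W + value t (lyap_op p F Z).
    rewrite -moment_valueD; apply: eq_bigr => i _; apply: eq_bigr => a _.
    by apply: eq_bigr => b _; rewrite [in LHS]ZW.
  by rewrite /value; lra.
under eq_fun do rewrite E.
have h : value t Z @[t --> \oo] --> \sum_i \sum_a \sum_b 0 * (mu i * S a b).
  under eq_fun do rewrite value_iter.
  do 3 (apply: cvg_fin_sum => ?); apply: cvgMl.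
  under eq_fun do rewrite -bilin_delta; exact: iter_lyap_cvg0.
rewrite big1 in h => [|i _]; last first.
  by rewrite big1 // => a _; rewrite big1 // => b _; rewrite mul0r.
have := cvgB (cvg_cst (initial_value Z)) h; rewrite subr0; exact.
Qed.

Definition stage_weight (i : 'I_n) : 'M[R]_d :=
  Q i + (gain K i)^T *m Rw i *m gain K i.

Lemma stage_costE t w : stage_cost A B Q Rw omega x0 K t w =
  quad_form (stage_weight (omega t w)) (closed_loop A B K omega x0 t w).
Proof. by rewrite /stage_cost /control quad_formD quad_form_mul quad_form_vN. Qed.

Lemma stage_weight_posdef i : sym_posdef (stage_weight i).
Proof.
have [Qs Q0] := Q_posdef i; have [Rs _] := Rw_posdef i; split.
  by rewrite linearD /= Qs !trmx_mul trmxK Rs mulmxA.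
move=> v v0; rewrite quad_formD quad_form_mul ltr_pwDl ?Q0 //.
exact: posdef_ge0.
Qed.

(** Monotone convergence turns the cost into the series of the values of the stage
    weight. *)
Lemma cost_value Z : coupled_lyapunov A B p Q Rw K Z ->
  cost A B Q Rw P omega x0 K = initial_value Z.
Proof.
move=> ZK.
have mean t := has_mean_moment_value A B K omega_markov x0_hist t stage_weight.
have costE : (fun t w => (stage_cost A B Q Rw omega x0 K t w)%:E) =
    fun t w => (quad_form (stage_weight (omega t w)) (closed_loop A B K omega x0 t w))%:E.
  by apply/funext => t; apply/funext => w; rewrite stage_costE.
rewrite /cost /extended_cost integral_nneseries //; last 2 first.
- move=> t; have [/integrableP[+ _] _] := mean t.
  by apply: eq_measurable_fun => w _; rewrite /= stage_costE.
- by move=> t w _; rewrite lee_fin stage_costE; apply/posdef_ge0/stage_weight_posdef.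
have -> : (fun m => \sum_(0 <= t < m) (\int[P]_w (stage_cost A B Q Rw omega x0 K t w)%:E)%E)%R
    = EFin \o series (value^~ stage_weight).
  apply/funext => m /=; rewrite /series /= -sumEFin; apply: eq_bigr => t _.
  under eq_integral do rewrite stage_costE.
  by have [_ ->] := mean t.
have cv := series_value ZK.
by rewrite EFin_lim; [rewrite (cvg_lim _ cv) | apply/cvg_ex; exists (initial_value Z)].
Qed.

(** The diagonal block [i] of [chi]. *)
Definition state_gramian (i : 'I_n) : 'M[R]_d :=
  limn (series (mode_moment A B P omega x0 K i)).

(** Every entry of the Gramian converges, because the equation with a matrix unit as
    source is solvable and [series_value] sums the corresponding series. *)
Lemma gramian_value (W Z : 'I_n -> 'M[R]_d) : (forall i, Z i = W i + lyap_op p F Z i) ->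
  \sum_i \sum_a \sum_b W i a b * state_gramian i a b = initial_value Z.
Proof.
move=> ZW.
have entry_cvg i a b : exists l : R,
    series (mode_moment A B P omega x0 K i) t a b @[t --> \oo] --> l.
  pose D (j : 'I_n) : 'M[R]_d := (j == i)%:R *: delta_mx a b.
  have [Y YD] := lyap_solve p_stochastic D Fst; exists (initial_value Y).
  have := series_value YD; apply: cvg_trans; apply: near_eq_cvg; apply: nearW => t.
  rewrite /series /= summxE; apply: eq_bigr => s _.
  rewrite /value /moment_value (sum_at_mode i _ (fun j => mode_moment A B P omega x0 K j s)).
  under eq_bigr do under eq_bigr do rewrite mulrC mxE.
  rewrite -[RHS]bilin_delta bilinE.
  by do 2 (apply: eq_bigr => ? _); rewrite !mxE eqxx !andbT -natrM mulnb.
have gram i a b : series (mode_moment A B P omega x0 K i) t a b @[t --> \oo]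
    --> state_gramian i a b.
  pose l := \matrix_(a, b) sval (cid (entry_cvg i a b)) : 'M[R]_d.
  have cl : series (mode_moment A B P omega x0 K i) @ \oo --> l.
    by apply: matrix_cvg => c e; rewrite mxE; exact: (svalP (cid (entry_cvg i c e))).
  by rewrite /state_gramian (cvg_lim _ cl) // mxE; exact: (svalP (cid (entry_cvg i a b))).
apply: cvg_unique _ (series_value ZW); first exact: norm_hausdorff.
have -> : series (value^~ W) = fun t =>
    \sum_i \sum_a \sum_b W i a b * series (mode_moment A B P omega x0 K i) t a b.
  apply/funext => t; rewrite /series /= exchange_big; apply: eq_bigr => i _.
  rewrite exchange_big; apply: eq_bigr => a _ /=.
  rewrite exchange_big; apply: eq_bigr => b _ /=.
  by rewrite summxE mulr_sumr.
by do 3 (apply: cvg_fin_sum => ?); apply: cvgMr; exact: gram.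
Qed.

Lemma initial_value_ge0 Z : (forall i v, 0 <= quad_form (Z i) v) ->
  0 <= initial_value Z.
Proof.
move=> Z0; rewrite -moment_value0.
exact: (moment_value_ge0 A B K omega_markov x0_hist).
Qed.

(** The solution of [Z = W + lyap_op p F Z] for [W = v v^T] placed at mode [i]
    dominates [W], so the Gramian dominates the initial second moment. *)
Lemma state_gramian_gt0 i v : sym_posdef S -> (forall i, 0 < mu i) -> v != 0 ->
  0 < quad_form (state_gramian i) v.
Proof.
move=> [_ S0] mu0 v0.
pose W (j : 'I_n) : 'M[R]_d := (j == i)%:R *: (v *m v^T).
have WE (M : 'I_n -> 'M[R]_d) :
    \sum_j \sum_a \sum_b W j a b * M j a b = quad_form (M i) v.
  rewrite sum_at_mode.
  rewrite -[RHS]/(bilin _ _ _) bilinE; apply: eq_bigr => a _; apply: eq_bigr => b _.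
  by rewrite !mxE big_ord1 mxE mulrC.
have [Z ZW] := lyap_solve p_stochastic W Fst.
rewrite -WE (gramian_value ZW).
have W0 j y : 0 <= quad_form (W j) y.
  rewrite quad_formZ mulr_ge0 // /quad_form mulmxA -mulmxA mxE big_ord1.
  have -> : (y^T *m v) 0 0 = (v^T *m y) 0 0.
    by rewrite !mxE; apply: eq_bigr => c _; rewrite !mxE mulrC.
  by rewrite -expr2 sqr_ge0.
have Z0 j y : 0 <= quad_form (Z j) y.
  apply: (lyap_ge0 p_stochastic Fst) => l z.
  by rewrite [in leRHS]ZW quad_formD lerDr.
have -> : initial_value Z = initial_value W + initial_value (lyap_op p F Z).
  rewrite -!moment_value0 -moment_valueD; apply: eq_bigr => j _; apply: eq_bigr => a _.
  by apply: eq_bigr => b _; rewrite [in LHS]ZW.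
rewrite ltr_pwDl //.
  have -> : initial_value W = mu i * quad_form S v; last by rewrite mulr_gt0 // S0.
  rewrite -quad_formZ -[RHS](WE (fun j => mu j *: S)).
  apply: eq_bigr => j _; apply: eq_bigr => a _.
  by apply: eq_bigr => b _; congr (_ * _); rewrite mxE.
apply: initial_value_ge0 => j y; rewrite quad_form_lyap sumr_ge0 // => l _.
by rewrite mulr_ge0 //; case: p_stochastic.
Qed.

End CostAndMoments.

(** * The Bellman equation at a neighbouring policy *)

Section PolicyPerturbation.
Context {R : realType} {n d k : nat}.
Variables (A : 'I_n -> 'M[R]_d) (B : 'I_n -> 'M[R]_(d, k)) (p : 'M[R]_n).
Variables (Q : 'I_n -> 'M[R]_d) (Rw : 'I_n -> 'M[R]_k).
Hypothesis p_stochastic : stochastic p.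
Hypothesis Q_posdef : forall i, sym_posdef (Q i).
Hypothesis Rw_posdef : forall i, sym_posdef (Rw i).
Variable K : @policy R n d k.
Hypothesis K_stable : lyap_stable p (closed_gain A B K).
Variable Pi : 'I_n -> 'M[R]_d.
Hypothesis Pi_sol : coupled_lyapunov A B p Q Rw K Pi.
Implicit Types (H : @policy R n d k) (v : 'cV[R]_d).

Let F := closed_gain A B K.

Lemma lyapunov_sym i : (Pi i)^T = Pi i.
Proof.
apply: (lyap_sol_tr p_stochastic K_stable Pi_sol) => j.
by case: (stage_weight_posdef Q_posdef Rw_posdef K j).
Qed.

Lemma lyapunov_ge0 i v : 0 <= quad_form (Pi i) v.
Proof.
apply: (lyap_ge0 p_stochastic K_stable) => j w.
rewrite [in leRHS]Pi_sol quad_formD lerDr.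
exact/posdef_ge0/(stage_weight_posdef Q_posdef Rw_posdef).
Qed.

Lemma mode_mean_sym i : (mode_mean p Pi i)^T = mode_mean p Pi i.
Proof.
rewrite /mode_mean linear_sum /=; apply: eq_bigr => j _.
by rewrite linearZ /= lyapunov_sym.
Qed.

Definition policy_hessian (i : 'I_n) : 'M[R]_k :=
  Rw i + (B i)^T *m mode_mean p Pi i *m B i.

(** Half the derivative of the right-hand side of the Bellman equation with respect to
    the gain, at the current gain; it vanishes at the gain that is greedy for [Pi]. *)
Definition policy_residual (i : 'I_n) : 'M[R]_(k, d) :=
  policy_hessian i *m gain K i - (B i)^T *m mode_mean p Pi i *m A i.

Lemma gainD H1 H2 i : gain (H1 + H2) i = gain H1 i + gain H2 i.
Proof. exact: submxrowD. Qed.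

Lemma bilin_residual u v i : bilin (policy_residual i) u v =
  bilin (Rw i) u (gain K i *m v) - bilin (mode_mean p Pi i) (B i *m u) (F i *m v).
Proof.
rewrite /policy_residual /policy_hessian bilinB bilin_mulr bilinD !bilin_mul.
rewrite /F /closed_gain mulmxBl -[- (_ *m v)]scaleN1r bilinDr bilinZr mulmxA.
by lra.
Qed.

(** The right-hand side of the Bellman equation is quadratic in the gain; this is its
    expansion around [K], where [Pi] solves the equation. *)
Lemma bellman_perturbation H i v :
  quad_form (stage_weight Q Rw (K + H) i) v
    + quad_form (lyap_op p (closed_gain A B (K + H)) Pi i) v
  = quad_form (Pi i) v + 2 * bilin (policy_residual i) (gain H i *m v) v
    + quad_form (policy_hessian i) (gain H i *m v).
Proof.
set h := gain H i *m v; set E := mode_mean p Pi i.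
have Es : E^T = E by exact: mode_mean_sym.
have [Rs _] := Rw_posdef i.
have FKH : closed_gain A B (K + H) i *m v = F i *m v + (-1) *: (B i *m h).
  by rewrite scaleN1r /F /closed_gain gainD mulmxDr opprD addrA mulmxBl mulmxA.
rewrite bilin_residual /policy_hessian [in quad_form (Pi i) v]Pi_sol !quad_formD !quad_form_mul.
rewrite -/E FKH -/(F i) gainD mulmxDl -/h !quad_form_vD // bilinZr quad_form_vZ.
rewrite [bilin (Rw i) h _]bilinC // [bilin E (B i *m h) _]bilinC //.
by lra.
Qed.
End PolicyPerturbation.

(** * Response of the cost-to-go to a change of policy *)

Section CostDerivative.
Context {R : realType} {n d k : nat}.
Variables (A : 'I_n -> 'M[R]_d) (B : 'I_n -> 'M[R]_(d, k)) (p : 'M[R]_n).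
Variables (Q : 'I_n -> 'M[R]_d) (Rw : 'I_n -> 'M[R]_k).
Hypothesis p_stochastic : stochastic p.
Hypothesis Q_posdef : forall i, sym_posdef (Q i).
Hypothesis Rw_posdef : forall i, sym_posdef (Rw i).
Variable K : @policy R n d k.
Hypothesis K_stable : lyap_stable p (closed_gain A B K).
Variable Pi : 'I_n -> 'M[R]_d.
Hypothesis Pi_sol : coupled_lyapunov A B p Q Rw K Pi.
Implicit Types (H : @policy R n d k) (v : 'cV[R]_d).

Let F := closed_gain A B K.
Let L := policy_residual A B p Rw K Pi.
Let hess := policy_hessian B p Rw Pi.
Local Notation nrm v := (quad_form 1%:M v).

(** The part of the expansion [bellman_perturbation] that is linear in [H]. *)
Definition linear_weight H (i : 'I_n) : 'M[R]_d :=
  (gain H i)^T *m L i + (L i)^T *m gain H i.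

Lemma linear_weight_sym H i : (linear_weight H i)^T = linear_weight H i.
Proof. by rewrite /linear_weight linearD /= !trmx_mul !trmxK addrC. Qed.

Lemma quad_form_linear_weight H i v :
  quad_form (linear_weight H i) v = 2 * bilin (L i) (gain H i *m v) v.
Proof.
rewrite quad_formD -[quad_form ((L i)^T *m _) v]quad_form_tr trmx_mul trmxK.
by rewrite -[quad_form _ _]/(bilin _ v v) bilin_mull; lra.
Qed.

Lemma gain_le H i v : nrm (gain H i *m v) <= `|H| ^+ 2 * (2 * (k * (d * d))%:R * nrm v).
Proof.
have -> : `|H| ^+ 2 * (2 * (k * (d * d))%:R * nrm v)
    = 2 * (k * (d * d))%:R * `|H| ^+ 2 * nrm v by ring.
apply: quad_form1_mul_le => a b; rewrite /gain mxE; exact: entry_le_norm.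
Qed.

Lemma perturbation_bounds : exists a b, [/\ 0 <= a, 0 <= b &
  forall H i v, `|quad_form (linear_weight H i) v| <= `|H| * (a * nrm v) /\
    `|quad_form (hess i) (gain H i *m v)| <= `|H| ^+ 2 * (b * nrm v)].
Proof.
have [cL cL0 cLP] := bilin_family_le L; have [cS cS0 cSP] := bilin_family_le hess.
pose g : R := 2 * (k * (d * d))%:R; have g0 : 0 <= g by rewrite mulr_ge0.
exists (2 * (cL * (g + 1))), (2 * cS * g); split; rewrite ?mulr_ge0 ?addr_ge0 //.
move=> H i v; have Hv := gain_le H i v; rewrite -/g in Hv; split.
  rewrite quad_form_linear_weight normrM ger0_norm //.
  have := bilin_scale_le v (cLP i) cL0 (normr_ge0 H) Hv; lra.
apply: le_trans (bilin_quad_le _ (cSP i)) _.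
have -> : `|H| ^+ 2 * (2 * cS * g * nrm v) = 2 * cS * (`|H| ^+ 2 * (g * nrm v)) by ring.
by rewrite ler_wpM2l ?mulr_ge0.
Qed.

Lemma coupled_lyapunovZ c i : (c \*: Pi) i =
  (c \*: stage_weight Q Rw K) i + lyap_op p F (c \*: Pi) i.
Proof. by rewrite lyap_opZ /= -scalerDr [in LHS]Pi_sol. Qed.

(** [a *: Pi] and its opposite are a super- and a subsolution of the equation of [Z]. *)
Lemma linear_response_le a H Z : 0 <= a ->
    (forall i v, `|quad_form (linear_weight H i) v| <= a * quad_form (Q i) v) ->
    (forall i, Z i = linear_weight H i + lyap_op p F Z i) ->
  forall i v, `|quad_form (Z i) v| <= a * quad_form (Pi i) v.
Proof.
move=> a0 Ha ZH i v.
have QW j x : a * quad_form (Q j) x <= a * quad_form (stage_weight Q Rw K j) x.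
  rewrite ler_wpM2l // quad_formD lerDl quad_form_mul.
  exact: posdef_ge0.
rewrite ler_norml -mulNr -!quad_formZ; apply/andP; split.
  apply: (lyap_sol_le p_stochastic K_stable (coupled_lyapunovZ (- a)) ZH) => j x.
  by have := Ha j x; have := QW j x; rewrite /= quad_formZ ler_norml => ? /andP[? _]; lra.
apply: (lyap_sol_le p_stochastic K_stable ZH (coupled_lyapunovZ a)) => j x.
by have := Ha j x; have := QW j x; rewrite /= quad_formZ ler_norml => ? /andP[_ ?]; lra.
Qed.

(** The closed-loop matrices change by [B_i H_i]; the cross term of the quadratic form
    is of order [`|H|] by [bilin_scale_le], and the remaining term is smaller. *)
Lemma lyap_perturbation_bound : exists2 c, 0 <= c &
  forall H (Z : 'I_n -> 'M[R]_d) z, `|H| <= 1 -> 0 <= z ->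
    (forall i, (Z i)^T = Z i) ->
    (forall i v, `|quad_form (Z i) v| <= z * nrm v) ->
  forall i v, `|quad_form (lyap_op p (closed_gain A B (K + H)) Z i) v
                - quad_form (lyap_op p F Z i) v| <= `|H| * (z * (c * nrm v)).
Proof.
have [cB cB0 cBP] := bilin_family_le (fun i => (B i)^T *m B i).
have [cF cF0 cFP] := bilin_family_le (fun i => (F i)^T *m F i).
pose g : R := 2 * (k * (d * d))%:R; have g0 : 0 <= g by rewrite mulr_ge0.
exists (2 * (2 * cB * g + 2 * cF) + 2 * cB * g) => [|H Z z H1 z0 Zs Zz i v].
  by rewrite !addr_ge0 ?mulr_ge0 ?addr_ge0 ?mulr_ge0.
set h := `|H|; have h0 : 0 <= h by exact: normr_ge0.
have v0 := quad_form1_ge0 v.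
pose b := B i *m (gain H i *m v).
have bv : nrm b <= h ^+ 2 * (2 * cB * g * nrm v).
  rewrite /b -quad_form_mul mulmx1 (le_trans (ler_norm _)) //.
  rewrite (le_trans (bilin_quad_le _ (cBP i))) //.
  have -> : h ^+ 2 * (2 * cB * g * nrm v) = 2 * cB * (h ^+ 2 * (g * nrm v)) by ring.
  by rewrite ler_wpM2l ?mulr_ge0 // gain_le.
have Fv : nrm (F i *m v) <= 2 * cF * nrm v.
  rewrite -quad_form_mul mulmx1 (le_trans (ler_norm _)) //.
  exact: bilin_quad_le (cFP i).
have FHv : closed_gain A B (K + H) i *m v = F i *m v + (-1) *: b.
  by rewrite scaleN1r /F /b /closed_gain gainD mulmxDr opprD addrA mulmxBl mulmxA.
have diff j : `|quad_form (Z j) (F i *m v + (-1) *: b) - quad_form (Z j) (F i *m v)|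
    <= h * (z * ((2 * (2 * cB * g + 2 * cF) + 2 * cB * g) * nrm v)).
  have cross : `|bilin (Z j) b (F i *m v)|
      <= h * (z * (2 * cB * g * nrm v + 2 * cF * nrm v)).
    apply: le_trans (bilin_scale_le _ (fun u w => bilin_polar_le u w (Zs j) (Zz j)) z0 h0 bv) _.
    by rewrite !ler_wpM2l // lerD2l.
  have diag : `|quad_form (Z j) b| <= h * (z * (2 * cB * g * nrm v)).
    apply: le_trans (Zz j b) _; rewrite mulrCA ler_wpM2l //; apply: le_trans bv _.
    rewrite expr2 -mulrA ler_wpM2l // ler_piMl // !mulr_ge0 //.
  rewrite quad_form_vD // bilinZr quad_form_vZ bilinC //.
  move: cross diag; rewrite !ler_norml => /andP[? ?] /andP[? ?].
  by apply/andP; split; lra.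
rewrite !quad_form_lyap -sumrB FHv.
apply: le_trans (ler_norm_sum _ _ _) _.
have -> : h * (z * ((2 * (2 * cB * g + 2 * cF) + 2 * cB * g) * nrm v)) =
  \sum_j p i j * (h * (z * ((2 * (2 * cB * g + 2 * cF) + 2 * cB * g) * nrm v))).
  by rewrite -mulr_suml; case: p_stochastic => _ ->; rewrite mul1r.
have p0 j : 0 <= p i j by case: p_stochastic.
by apply: ler_sum => j _; rewrite -mulrBr normrM ger0_norm // ler_wpM2l.
Qed.

(** In [bellman_perturbation] the terms that depend on [H] are of order [`|H|], and
    half of the definite weight [Q] absorbs them. *)
Lemma perturbed_decrease : exists2 e, 0 < e & forall H, `|H| <= e ->
  forall i v, quad_form (lyap_op p (closed_gain A B (K + H)) Pi i) v
              <= quad_form (Pi i) v - 2^-1 * quad_form (Q i) v.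
Proof.
have [a [b [a0 b0 ab]]] := perturbation_bounds.
have [cQ cQ0 cQP] := posdef_family_coercive Q_posdef.
(* This radius gives [`|H| <= 1] and [`|H| * (a + b) * cQ <= 1 / 2]. *)
pose e := (1 + 2 * cQ * (a + b))^-1.
have e0 : 0 < 1 + 2 * cQ * (a + b) by rewrite ltr_pwDl // !mulr_ge0 ?addr_ge0 // ltW.
exists e => [|H]; first by rewrite invr_gt0.
rewrite -[e]mul1r ler_pdivlMr // => He i v.
have h0 : 0 <= `|H| by exact: normr_ge0.
have := bellman_perturbation p_stochastic Q_posdef Rw_posdef K_stable Pi_sol H i v.
have [l1 l2] := ab H i v; rewrite -/hess -/L => bell.
have W : quad_form (Q i) v <= quad_form (stage_weight Q Rw (K + H) i) v.
  by rewrite quad_formD quad_form_mul lerDl; exact: posdef_ge0.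
rewrite quad_form_linear_weight in l1.
have v0 := quad_form1_ge0 v; have vQ := cQP i v; have Qv0 := posdef_ge0 v (Q_posdef i).
have H1 : `|H| <= 1.
  by have : 0 <= `|H| * (2 * cQ * (a + b)); [rewrite !mulr_ge0 ?addr_ge0 // ltW | lra].
have sq : `|H| ^+ 2 * (b * nrm v) <= `|H| * (b * nrm v).
  by rewrite ler_wpM2r ?mulr_ge0 // expr2 ler_piMl.
have half : `|H| * ((a + b) * nrm v) <= 2^-1 * quad_form (Q i) v.
  apply: le_trans (_ : `|H| * ((a + b) * (cQ * quad_form (Q i) v)) <= _).
    by rewrite !ler_wpM2l ?addr_ge0.
  have : `|H| * (2 * cQ * (a + b)) * quad_form (Q i) v <= 1 * quad_form (Q i) v.
    by rewrite ler_wpM2r //; lra.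
  by lra.
move: l1 l2; rewrite !ler_norml => /andP[_ l1] /andP[_ l2]; lra.
Qed.

Lemma perturbed_stable H :
    (forall i v, quad_form (lyap_op p (closed_gain A B (K + H)) Pi i) v
       <= quad_form (Pi i) v - 2^-1 * quad_form (Q i) v) ->
  lyap_stable p (closed_gain A B (K + H)).
Proof.
move=> dec; apply: (@lyap_criterion _ _ _ _ p_stochastic _ Pi (fun i => 2^-1 *: Q i)).
- move=> i; have [Qs Q0] := Q_posdef i; split; first by rewrite linearZ /= Qs.
  by move=> v v0; rewrite quad_formZ mulr_gt0 // Q0.
- exact: (lyapunov_ge0 p_stochastic Q_posdef Rw_posdef K_stable Pi_sol).
- by move=> i v; rewrite quad_formZ; exact: dec.
Qed.

(** The remainder [U = Pi' - Pi - Z] solves the Lyapunov equation of the perturbed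
    policy with a source of order [`|H| ^+ 2], for which a multiple of [Pi] is a
    supersolution. *)
Lemma perturbed_solution : exists c e, [/\ 0 <= c, 0 < e &
  forall H, `|H| <= e -> lyap_stable p (closed_gain A B (K + H)) /\
    forall Z Pi', (forall i, Z i = linear_weight H i + lyap_op p F Z i) ->
      coupled_lyapunov A B p Q Rw (K + H) Pi' ->
    forall i v, `|quad_form (Pi' i - Pi i - Z i) v|
                <= c * `|H| ^+ 2 * quad_form (Pi i) v].
Proof.
have [a [b [a0 b0 ab]]] := perturbation_bounds.
have [cQ cQ0 cQP] := posdef_family_coercive Q_posdef.
have [cP cP0 cPP] := bilin_family_le Pi.
have [f f0 fP] := lyap_perturbation_bound.
have [e e0 dec] := perturbed_decrease.
pose z := a * cQ * (2 * cP).
have z0 : 0 <= z by rewrite !mulr_ge0 // ltW.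
exists (2 * (b + z * f) * cQ), (Num.min 1 e); split.
- by rewrite !mulr_ge0 ?addr_ge0 ?mulr_ge0 // ltW.
- by rewrite lt_min ltr01.
move=> H; rewrite le_min => /andP[H1 /dec {}dec].
have st := perturbed_stable dec; split=> // Z Pi' ZH Pi'H.
have h0 : 0 <= `|H| by exact: normr_ge0.
set h := `|H| in h0 H1 *.
have ZP i v : `|quad_form (Z i) v| <= h * a * cQ * quad_form (Pi i) v.
  apply: linear_response_le ZH i v => [|i v]; first by rewrite !mulr_ge0 // ltW.
  have [l _] := ab H i v; apply: le_trans l _.
  by rewrite -/h -!mulrA !ler_wpM2l.
have Zz i v : `|quad_form (Z i) v| <= h * z * nrm v.
  apply: le_trans (ZP i v) _.
  have -> : h * z * nrm v = h * a * cQ * (2 * cP * nrm v) by rewrite /z; ring.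
  rewrite ler_wpM2l ?mulr_ge0 //; first exact: ltW.
  exact: le_trans (ler_norm _) (bilin_quad_le _ (cPP i)).
have Zs := lyap_sol_tr p_stochastic K_stable ZH (linear_weight_sym H).
have hz0 : 0 <= h * z by rewrite mulr_ge0.
have lyapZ := fP H Z _ H1 hz0 Zs Zz.
pose C := 2 * (b + z * f) * cQ * h ^+ 2.
have C0 : 0 <= C by rewrite /C !mulr_ge0 ?addr_ge0 ?mulr_ge0 ?sqr_ge0 // ltW.
pose U i := Pi' i - Pi i - Z i.
have UE G : lyap_op p G U = fun i => lyap_op p G Pi' i - lyap_op p G Pi i - lyap_op p G Z i.
  have -> : U = Pi' \+ (-1) \*: Pi \+ (-1) \*: Z.
    by apply/funext => i /=; rewrite !scaleN1r.
  by rewrite !lyap_opD !lyap_opZ; apply/funext => i /=; rewrite !scaleN1r.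
(* The two signs give the upper and the lower bound on the form of [U]. *)
suff sgn (s : R) : s ^+ 2 = 1 -> forall i v, 0 <= quad_form ((C \*: Pi \+ s \*: U) i) v.
  move=> i v; have := sgn 1 (expr1n _ _) i v.
  have := sgn (-1) (etrans (sqrrN 1) (expr1n _ 2)) i v.
  have q (s : R) : quad_form ((C \*: Pi \+ s \*: U) i) v =
    C * quad_form (Pi i) v + s * quad_form (U i) v.
    by rewrite quad_formD !quad_formZ.
  by rewrite !q -/(U i) -/h -/C ler_norml => ? ?; apply/andP; split; lra.
move=> s1; apply: (@lyap_ge0 _ _ _ _ p_stochastic _ (C \*: Pi \+ s \*: U) st) => i v.
have Cdec : C * quad_form (lyap_op p (closed_gain A B (K + H)) Pi i) v <=
   C * (quad_form (Pi i) v - 2^-1 * quad_form (Q i) v) by rewrite ler_wpM2l.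
have [_ l2] := ab H i v; have l3 := lyapZ i v.
have bell := bellman_perturbation p_stochastic Q_posdef Rw_posdef K_stable Pi_sol H i v.
rewrite -/hess -/L -quad_form_linear_weight in bell.
have Pi'E : quad_form (Pi' i) v = quad_form (stage_weight Q Rw (K + H) i) v
   + quad_form (lyap_op p (closed_gain A B (K + H)) Pi' i) v.
  by rewrite [in LHS]Pi'H quad_formD.
have ZE : quad_form (Z i) v = quad_form (linear_weight H i) v
   + quad_form (lyap_op p F Z i) v by rewrite [in LHS]ZH quad_formD.
have small : h ^+ 2 * (b * nrm v) + h * (h * z * (f * nrm v))
    <= C * (2^-1 * quad_form (Q i) v).
  have -> : C * (2^-1 * quad_form (Q i) v)
      = h ^+ 2 * (b + z * f) * (cQ * quad_form (Q i) v).
    by rewrite /C; field.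
  have -> : h ^+ 2 * (b * nrm v) + h * (h * z * (f * nrm v))
      = h ^+ 2 * (b + z * f) * nrm v by ring.
  by rewrite ler_wpM2l ?cQP // mulr_ge0 ?sqr_ge0 ?addr_ge0 ?mulr_ge0 ?(ltW cQ0).

rewrite lyap_opD !lyap_opZ UE /= !quad_formD !quad_formZ /U !quad_formB.
move: l2 l3; rewrite -/h !ler_norml => /andP[? ?] /andP[? ?].
have : (s == 1) || (s == -1) by rewrite -eqf_sqr s1 expr1n.
by move=> /orP[/eqP ->|/eqP ->]; lra.
Qed.

End CostDerivative.

(** * The gradient of the cost *)

Section CostGradient.
Context {R : realType} {n d k : nat}.
Variables (A : 'I_n -> 'M[R]_d) (B : 'I_n -> 'M[R]_(d, k)) (p : 'M[R]_n).
Variables (Q : 'I_n -> 'M[R]_d) (Rw : 'I_n -> 'M[R]_k).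
Hypothesis p_stochastic : stochastic p.
Hypothesis Q_posdef : forall i, sym_posdef (Q i).
Hypothesis Rw_posdef : forall i, sym_posdef (Rw i).
Context {dT : measure_display} {T : measurableType dT} (P : probability T R).
Variables (mu : 'I_n -> R) (omega : nat -> T -> 'I_n) (x0 : T -> 'cV[R]_d).
Variable S : 'M[R]_d.
Hypothesis omega_markov : markov_chain P p mu omega.
Hypothesis x0_hist : history_uncorrelated P omega x0 S.
Hypothesis S_sym : S^T = S.
Variable K : @policy R n d k.
Hypothesis K_stable : lyap_stable p (closed_gain A B K).
Variable Pi : 'I_n -> 'M[R]_d.
Hypothesis Pi_sol : coupled_lyapunov A B p Q Rw K Pi.
Implicit Types (H : @policy R n d k) (Z : 'I_n -> 'M[R]_d).

Let F := closed_gain A B K.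
Let L := policy_residual A B p Rw K Pi.
Let iv := initial_value mu S.

Lemma initial_valueD Z Y : iv (Z \+ Y) = iv Z + iv Y.
Proof.
rewrite /iv /initial_value -big_split; apply: eq_bigr => i _.
rewrite -big_split; apply: eq_bigr => a _; rewrite -big_split.
by apply: eq_bigr => b _; rewrite /= mxE mulrDl.
Qed.

Lemma initial_valueZ c Z : iv (c \*: Z) = c * iv Z.
Proof.
rewrite /iv /initial_value mulr_sumr; apply: eq_bigr => i _.
rewrite mulr_sumr; apply: eq_bigr => a _; rewrite mulr_sumr.
by apply: eq_bigr => b _; rewrite /= mxE -mulrA.
Qed.

Lemma initial_value_tr Z : iv (fun i => (Z i)^T) = iv Z.
Proof.
apply: eq_bigr => i _; rewrite exchange_big; apply: eq_bigr => a _.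
apply: eq_bigr => b _; have -> : S b a = S a b by rewrite -{1}S_sym mxE.
by rewrite mxE.
Qed.

Definition cost_gradient : 'M[R]_(k, \sum_(i < n) d) :=
  (\mxrow_(i < n) (2 *: L i)) *m chi A B P omega x0 K.

Lemma trace_cost_gradient H : \tr (H^T *m cost_gradient) =
  2 * \sum_i \tr ((gain H i)^T *m (L i *m state_gramian A B P omega x0 K i)).
Proof.
rewrite /cost_gradient mul_mxrow_mxdiag -[in LHS](submxrowK (q_ := fun=> d) H).
rewrite tr_mxrow mxtrace_mulC mul_mxrow_mxcol linear_sum mulr_sumr /=.
apply: eq_bigr => i _.
by rewrite -!scalemxAl linearZ /= [in RHS]mxtrace_mulC.
Qed.

(** [Z] is the sum of the solution with source [L_i^T H_i] and of its transpose, which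
    have the same initial value; [gramian_value] evaluates the former. *)
Lemma linear_response_value H Z :
    (forall i, Z i = linear_weight A B p Rw K Pi H i + lyap_op p F Z i) ->
  iv Z = \tr (H^T *m cost_gradient).
Proof.
move=> ZH; pose Y i := (L i)^T *m gain H i.
have [Z1 Z1Y] := lyap_solve p_stochastic Y K_stable.
have -> : Z = Z1 \+ (fun i => (Z1 i)^T).
  apply: (lyap_unique p_stochastic K_stable ZH) => i.
  have -> : linear_weight A B p Rw K Pi H i = Y i + (Y i)^T.
    by rewrite /linear_weight /Y trmx_mul trmxK addrC.
  by rewrite lyap_opD /= -lyap_op_tr [in LHS]Z1Y linearD /= addrACA.
rewrite initial_valueD initial_value_tr trace_cost_gradient.
rewrite /iv -(gramian_value p_stochastic omega_markov x0_hist K_stable Z1Y).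
rewrite mulr_natl mulr2n; congr (_ + _); apply: eq_bigr => i _;
by rewrite sum_mul_entries -[Y i]/((L i)^T *m gain H i) trmx_mul trmxK mulmxA.
Qed.

Lemma cost_gradient_linear : linear (fun H : policy => \tr (H^T *m cost_gradient) : R^o).
Proof. by move=> a H1 H2; rewrite linearP mulmxDl -scalemxAl linearP. Qed.

(** By [perturbed_solution], the cost at [K + H] is the cost at [K] plus the linear
    response plus the initial value of a family of order [`|H| ^+ 2]. *)
Lemma diff_cost :
  'd (cost A B Q Rw P omega x0) K = (fun H => \tr (H^T *m cost_gradient)) :> (_ -> _).
Proof.
pose df : {linear policy -> R^o} := HB.pack
  (fun H : policy => \tr (H^T *m cost_gradient) : R^o)
  (GRing.isLinear.Build _ _ _ _ _ cost_gradient_linear).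
apply: (diff_unique (df := df)).
  have -> : (df : policy -> R^o) = fun H => \sum_a \sum_b H a b * cost_gradient a b.
    by apply/funext => H; rewrite /df /= -sum_mul_entries.
  exact: entry_sum_continuous.
apply/eqaddoP => eps eps0.
have [c [e [c0 e0 main]]] :=
  perturbed_solution p_stochastic Q_posdef Rw_posdef K_stable Pi_sol.
have ivPi : 0 <= iv Pi.
  apply: (initial_value_ge0 A B omega_markov x0_hist K) => i v.
  exact: (lyapunov_ge0 p_stochastic Q_posdef Rw_posdef K_stable Pi_sol).
(* For [`|H|] below this radius, [c * `|H| ^+ 2 * iv Pi <= eps * `|H|]. *)
have r0 : 0 < eps / (c * iv Pi + 1) by rewrite divr_gt0 // ltr_wpDl // mulr_ge0.
near=> H.
have He : `|H| <= e.
  near: H; exact: (@nbhs0_le R (@policy R n d k) e e0).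
have Heps : `|H| <= eps / (c * iv Pi + 1).
  near: H; exact: (@nbhs0_le R (@policy R n d k) _ r0).
have [st err] := main H He.
have [Z ZH] := lyap_solve p_stochastic (linear_weight A B p Rw K Pi H) K_stable.
have [Pi' Pi'H] := lyap_solve p_stochastic (stage_weight Q Rw (K + H)) st.
have {}err := err Z Pi' ZH Pi'H.
pose U i := Pi' i - Pi i - Z i.
have Pi'E : Pi' = Pi \+ Z \+ U.
  by apply/funext => i; rewrite /U /= -[Pi' i - _ - _]addrA -opprD [RHS]addrC subrK.
have -> : (cost A B Q Rw P omega x0 \o shift K
    - (cst (cost A B Q Rw P omega x0 K) + df)) H = iv U.
  have -> : (cost A B Q Rw P omega x0 \o shift K
    - (cst (cost A B Q Rw P omega x0 K) + df)) H
    = cost A B Q Rw P omega x0 (K + H)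
      - (cost A B Q Rw P omega x0 K + \tr (H^T *m cost_gradient)).
    by rewrite [K + H]addrC.
  rewrite (cost_value p_stochastic Q_posdef Rw_posdef omega_markov x0_hist st Pi'H).
  rewrite (cost_value p_stochastic Q_posdef Rw_posdef omega_markov x0_hist K_stable Pi_sol).
  rewrite -(linear_response_value ZH) -/(iv Pi') -/(iv Pi) Pi'E !initial_valueD.
  by lra.
have bound (s : R) : `|s| = 1 -> 0 <= c * `|H| ^+ 2 * iv Pi + s * iv U.
  move=> s1; rewrite -!initial_valueZ -initial_valueD.
  apply: (initial_value_ge0 A B omega_markov x0_hist K) => i v.
  have -> : quad_form (((c * `|H| ^+ 2) \*: Pi \+ s \*: U) i) v
      = c * `|H| ^+ 2 * quad_form (Pi i) v + s * quad_form (U i) v.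
    by rewrite quad_formD !quad_formZ.
  have := err i v; rewrite -/(U i).
  have <- : `|s * quad_form (U i) v| = `|quad_form (U i) v| by rewrite normrM s1 mul1r.
  by rewrite ler_norml => /andP[]; lra.
apply: le_trans (_ : c * `|H| ^+ 2 * iv Pi <= _).
  have := bound 1 (normr1 _); have := bound (-1) (normrN1 _).
  by rewrite ler_norml => ? ?; apply/andP; split; lra.
move: Heps; rewrite ler_pdivlMr ?ltr_wpDl ?mulr_ge0 // => Heps.
have h0 := normr_ge0 H.
apply: le_trans (_ : `|H| * (`|H| * (c * iv Pi + 1)) <= _).
  have := sqr_ge0 `|H|; lra.
by rewrite [eps * _]mulrC ler_wpM2l.
Unshelve. all: by end_near. Qed.

Lemma gradient_cost : gradient (cost A B Q Rw P omega x0) K = cost_gradient.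
Proof.
apply: xget_unique => [H|G HG]; first by rewrite diff_cost.
apply/eqP; rewrite -subr_eq0; apply/eqP/matrixP => a b; rewrite [RHS]mxE.
have := HG (delta_mx a b); rewrite diff_cost => /esym/eqP.
by rewrite -subr_eq0 -raddfB /= -mulmxBr trace_delta_mul => /eqP.
Qed.

(** The quadratic form of a block diagonal matrix is the sum of those of its blocks, so
    [chi] is definite because the Gramians are. *)
Lemma chi_unit : sym_posdef S -> (forall i, 0 < mu i) -> chi A B P omega x0 K \in unitmx.
Proof.
move=> Spd mu0; pose X := state_gramian A B P omega x0 K.
have X_gt0 i v : v != 0 -> 0 < quad_form (X i) v.
  exact: (state_gramian_gt0 p_stochastic omega_markov x0_hist K_stable).
have X_ge0 i v : 0 <= quad_form (X i) v.
  by have [->|/X_gt0/ltW//] := eqVneq v 0; rewrite quad_form_v0.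
apply: posdef_unit => v v0; pose w := submxcol (p_ := fun=> d) v.
have -> : quad_form (chi A B P omega x0 K) v = \sum_i quad_form (X i) (w i).
  rewrite /quad_form -[v](submxcolK (p_ := fun=> d)) tr_mxcol.
  rewrite mul_mxrow_mxdiag mul_mxrow_mxcol summxE.
  by [].
have [i wi] : exists i, w i != 0.
  apply/existsP; apply: contraNT v0; rewrite negb_exists => /forallP w0.
  rewrite -[v](submxcolK (p_ := fun=> d)) -[X in _ == X](mxcol0 (p_ := fun=> d)).
  by apply/eqP/eq_mxcol => i; apply/eqP; rewrite -[_ == _]negbK; exact: w0.
by rewrite (bigD1 i) //= ltr_pwDl ?X_gt0 // sumr_ge0.
Qed.

Lemma natural_gradient : sym_posdef S -> (forall i, 0 < mu i) ->
  gradient (cost A B Q Rw P omega x0) K *m invmx (chi A B P omega x0 K)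
  = \mxrow_(i < n) (2 *: L i).
Proof. by move=> Spd mu0; rewrite gradient_cost /cost_gradient mulmxK // chi_unit. Qed.

End CostGradient.

(** * The spectral norm and the policy improvement *)

Lemma euclid_norm_block {R : realType} (n k : nat) (i : 'I_n) (u : 'cV[R]_k) :
  let e := \mxcol_(j < n) (if j == i then u else 0) in
  euclid_norm e = euclid_norm u.
Proof.
rewrite /euclid_norm -!quad_form1; congr Num.sqrt.
rewrite /quad_form !mulmx1 tr_mxcol mul_mxrow_mxcol summxE (bigD1 i) //=.
by rewrite eqxx big1 ?addr0 // => j /negPf ji; rewrite ji mulmx0 mxE.
Qed.

Lemma euclid_normZ {R : realType} m c (v : 'cV[R]_m) :
  euclid_norm (c *: v) = `|c| * euclid_norm v.
Proof.
rewrite /euclid_norm -!quad_form1 quad_form_vZ sqrtrM ?sqr_ge0 //.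
by rewrite sqrtr_sqr.
Qed.

(** The entries of [M^T M] bound the set whose supremum is taken; homogeneity extends
    the inequality beyond the unit ball. *)
Lemma spectral_norm_bound {R : realType} m m' (M : 'M[R]_(m, m')) v :
  euclid_norm (M *m v) <= spectral_norm M * euclid_norm v.
Proof.
have [->|v0] := eqVneq v 0.
  by rewrite mulmx0 /euclid_norm -!quad_form1 !quad_form_v0 sqrtr0 mulr0.
pose c := 2 * entry_sum (M^T *m M).
have Mc w : quad_form 1%:M (M *m w) <= c * quad_form 1%:M w.
  by rewrite -quad_form_mul mulmx1 (le_trans (ler_norm _)) // quad_form_le.
have c0 : 0 <= c by rewrite mulr_ge0 // entry_sum_ge0.
have r0 : 0 < euclid_norm v.
  by have := proj2 (@posdef1 R m') v v0; rewrite /euclid_norm -quad_form1 sqrtr_gt0.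
rewrite -ler_pdivrMr //.
have -> : euclid_norm (M *m v) / euclid_norm v
    = euclid_norm (M *m ((euclid_norm v)^-1 *: v)).
  by rewrite -scalemxAr euclid_normZ ger0_norm ?invr_ge0 ?(ltW r0) // mulrC.
apply: (ub_le_sup _
  (E := [set euclid_norm (M *m w) | w in [set w | euclid_norm w <= 1]])).
  exists (Num.sqrt c) => _ [w /= w1 <-].
  rewrite /euclid_norm -quad_form1 ler_wsqrtr // (le_trans (Mc w)) //.
  rewrite ler_piMr // -euclid_normE -(expr1n _ 2) ler_pXn2r ?nnegrE //.
  exact: sqrtr_ge0.
exists ((euclid_norm v)^-1 *: v) => //=.
by rewrite euclid_normZ ger0_norm ?invr_ge0 ?(ltW r0) // mulVf ?gt_eqF.
Qed.

Section Improvement.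
Context {R : realType} {n d k : nat}.
Variables (A : 'I_n -> 'M[R]_d) (B : 'I_n -> 'M[R]_(d, k)) (p : 'M[R]_n).
Variables (Q : 'I_n -> 'M[R]_d) (Rw : 'I_n -> 'M[R]_k).
Hypothesis p_stochastic : stochastic p.
Hypothesis Q_posdef : forall i, sym_posdef (Q i).
Hypothesis Rw_posdef : forall i, sym_posdef (Rw i).
Variable K : @policy R n d k.
Hypothesis K_stable : lyap_stable p (closed_gain A B K).

Lemma lyapunov_solP : coupled_lyapunov A B p Q Rw K (lyapunov_sol A B p Q Rw K).
Proof.
have [Z ZK] := lyap_solve p_stochastic (stage_weight Q Rw K) K_stable.
exact: (@xgetPex _ (fun=> 0) [set Y | coupled_lyapunov A B p Q Rw K Y]
  (ex_intro _ Z ZK)).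
Qed.

Let Pi := lyapunov_sol A B p Q Rw K.
Let hess := policy_hessian B p Rw Pi.
Let L := policy_residual A B p Rw K Pi.

Lemma step_matrixE : step_matrix A B p Q Rw K = \mxdiag_(i < n) hess i.
Proof.
rewrite /step_matrix /hess /policy_hessian mxdiagD; congr (_ + _).
rewrite /block_diag tr_mxblock mul_mxblock_mxdiag mul_mxblock.
apply: eq_mxblock => i j; rewrite (bigD1 i) //= eqxx big1 ?addr0 => [|l /negPf li].
  have [->|_] := eqVneq i j; first by rewrite conform_mx_id.
  by rewrite mulmx0.
by rewrite li trmx0 !mul0mx.
Qed.

(** The vector that carries [u] in block [i] and vanishes elsewhere turns the
    norm of the block diagonal matrix into that of its block [i]. *)
Lemma hessian_le i u :
  quad_form (hess i) u <= spectral_norm (step_matrix A B p Q Rw K) * quad_form 1%:M u.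
Proof.
set s := spectral_norm _.
pose e := \mxcol_(j < n) (if j == i then u else 0).
have Me : step_matrix A B p Q Rw K *m e
    = \mxcol_(j < n) (if j == i then hess i *m u else 0).
  rewrite step_matrixE mul_mxdiag_mxcol; apply: eq_mxcol => j.
  by case: eqP => [->//|_]; rewrite mulmx0.
have := spectral_norm_bound (step_matrix A B p Q Rw K) e.
rewrite Me -/s !euclid_norm_block => le_s.
have -> : quad_form (hess i) u = bilin 1%:M u (hess i *m u).
  by rewrite /bilin mulmx1 mulmxA.
rewrite -euclid_normE expr2.
apply: le_trans (_ : euclid_norm u * euclid_norm (hess i *m u) <= _); last first.
  by rewrite mulrCA ler_wpM2l ?sqrtr_ge0.
rewrite (le_trans (ler_norm _)) // -(@ler_pXn2r _ 2) ?nnegrE ?mulr_ge0 ?sqrtr_ge0 //.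
by rewrite exprMn !euclid_normE real_normK ?num_real // bilin_sqr_le //; exact: posdef1.
Qed.

(** With [q] the squared norm of [L_i v], the perturbation [H_i = -2 eta L_i] changes
    the Bellman right-hand side by at most [- 4 eta q + 4 eta^2 s q <= - 2 eta q <= 0],
    so [Pi] decreases by at least the stage weight. *)
Lemma improvement_stable H s eta : 0 < eta -> 2 * eta * s <= 1 ->
    (forall i u, quad_form (hess i) u <= s * quad_form 1%:M u) ->
    (forall i, gain H i = (- (2 * eta)) *: L i) ->
  lyap_stable p (closed_gain A B (K + H)).
Proof.
move=> eta0 etas hs HL.
apply: (@lyap_criterion _ _ _ _ p_stochastic _ Pi (stage_weight Q Rw (K + H))).
- exact: stage_weight_posdef.
- exact: (lyapunov_ge0 p_stochastic Q_posdef Rw_posdef K_stable lyapunov_solP).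
move=> i v.
have := bellman_perturbation p_stochastic Q_posdef Rw_posdef K_stable lyapunov_solP H i v.
rewrite HL -/Pi -/L -/hess -scalemxAl bilinZl quad_form_vZ.
have -> : bilin (L i) (L i *m v) v = quad_form 1%:M (L i *m v).
  by rewrite /quad_form mulmx1 /bilin mulmxA.
have := hs i (L i *m v); have := quad_form1_ge0 (L i *m v).
set q := quad_form 1%:M _; set h := quad_form (hess i) _ => q0 hq.
have : eta ^+ 2 * h <= eta * (2^-1 * q).
  rewrite expr2 -mulrA ler_wpM2l ?(ltW eta0) //.
  apply: le_trans (ler_wpM2l (ltW eta0) hq) _.
  have : 2 * eta * s * q <= 1 * q by rewrite ler_wpM2r.
  by lra.
have := mulr_ge0 (ltW eta0) q0; rewrite sqrrN exprMn => *; lra.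
Qed.

End Improvement.

Theorem lemma4 (R : realType) (n d k : nat)
    (A : 'I_n -> 'M[R]_d) (B : 'I_n -> 'M[R]_(d, k)) (p : 'M[R]_n)
    (Q : 'I_n -> 'M[R]_d) (Rw : 'I_n -> 'M[R]_k)
    (p_stochastic : stochastic p)
    (Q_posdef : forall i, sym_posdef (Q i))
    (Rw_posdef : forall i, sym_posdef (Rw i))
    (dT : measure_display) (T : measurableType dT) (P : probability T R)
    (rho : 'I_n -> R) (omega : nat -> T -> 'I_n) (x0 : T -> 'cV[R]_d)
    (omega_markov : markov_chain P p rho omega)
    (rho_gt0 : forall i, 0 < rho i)
    (x0_random : random_vector x0)
    (x0_moment : finite_second_moment P x0)
    (x0_indep : independent_of_chain P x0 omega)
    (x0_posdef : sym_posdef (second_moment P x0))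
    (K : policy) (eta : R) :
  ms_stabilizing A B p K ->
  0 < eta <= 1 / (2 * spectral_norm (step_matrix A B p Q Rw K)) ->
  ms_stabilizing A B p (natural_gradient_step A B Q Rw P omega x0 eta K).
Proof.
move=> K_ms /andP[eta_gt0 eta_le].
have K_stable := ms_stabilizing_lyap_stable p_stochastic omega_markov rho_gt0 K_ms.
have x0_hist : history_uncorrelated P omega x0 (second_moment P x0).
  by apply: history_uncorrelated_indep => //; case: omega_markov.
have Pi_sol := lyapunov_solP Q Rw p_stochastic K_stable.
have s_gt0 : 0 < spectral_norm (step_matrix A B p Q Rw K).
  have := lt_le_trans eta_gt0 eta_le; rewrite mul1r invr_gt0.
  by rewrite pmulr_rgt0.
apply: lyap_stable_ms_stabilizing => //.
rewrite /natural_gradient_step (natural_gradient p_stochastic Q_posdef Rw_posdef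
  omega_markov x0_hist _ K_stable Pi_sol) //; last by case: x0_posdef.
apply: (improvement_stable p_stochastic Q_posdef Rw_posdef K_stable
  (s := spectral_norm (step_matrix A B p Q Rw K)) eta_gt0).
- move: eta_le; rewrite ler_pdivlMr; first by rewrite mulrCA mulrA.
  by rewrite mulr_gt0.
- by move=> i u; exact: hessian_le.
- move=> i; rewrite /gain submxrowN -mul_scalar_mx mul_mxrow mxrowK mul_scalar_mx.
  by rewrite scalerA mulrC scaleNr.
Qed.
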